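(* Let $V$ be a real vector space of finite dimension $n>0$, let $p,p'\ge0$ be integers with $p+p'=n$, let $\Gamma$ be the manifold of all scalar products of signature $(p,p')$ on $V$, and let $Q$ be the natural metric on $\Gamma$. For a basis $(v_i)$ of $V$ let $(\gamma^I)_{I=1,\dots,N}=(\gamma_{ij})_{i\le j}$, $N=n(n+1)/2$, be the corresponding global coordinates on $\Gamma$, $\phi=(\gamma^I):\Gamma\to\mathbb{R}^N$ the coordinate map, and $(Q_{IJ})$ the components of $Q$ in these coordinates. Let $d\mu_Q$ be the regular Borel measure on $\Gamma$ determined by $$\int_\Gamma f\,d\mu_Q=\int_{\phi(\Gamma)}\Big(f\sqrt{|\det Q_{IJ}|}\Big)\circ\phi^{-1}\,d\mu_L\qquad\text{for all continuous compactly supported } f:\Gamma\to\mathbb{R},$$ where $d\mu_L$ is the Lebesgue measure on $\mathbb{R}^N$. Then $d\mu_Q$ does not depend on the choice of the basis $(v_i)$, and $d\mu_Q$ is an invariant measure on $\Gamma$: $\bar g_\star d\mu_Q=d\mu_Q$ for every $g\in GL(V)$.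
   Context: A scalar product on $V$ is a non-degenerate symmetric bilinear form on $V$; its signature is $(p,p')$ if an orthonormal basis has $p$ vectors of square $+1$ and $p'$ of square $-1$. $\Gamma$ is an open subset of the vector space of symmetric bilinear forms on $V$. For a basis $(v_i)$ of $V$, $\gamma_{ij}(\gamma)=\gamma(v_i,v_j)$, and $(\gamma_{ij})_{i\le j}$ are global coordinates on $\Gamma$; $(\gamma^{ij})$ are the functions with $\gamma^{ik}\gamma_{kj}=\delta^i{}_j$. The natural metric on $\Gamma$ is $Q=\gamma^{ik}\gamma^{jl}\,d\gamma_{ij}\otimes d\gamma_{kl}$ (summation over all repeated indices from $1$ to $n$), which is a (pseudo-Riemannian) metric independent of the basis. $GL(V)$ acts on $\Gamma$ by $\bar g(\gamma)=(g^{-1})^*\gamma$, i.e. $(\bar g\gamma)(v,v')=\gamma(g^{-1}v,g^{-1}v')$. $\bar g_\star$ denotes pushforward of measures: $\int f\,(\bar g_\star d\mu)=\int (f\circ\bar g)\,d\mu$ for continuous compactly supported $f$. *)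

(* Defs.v *)
From HB Require Import structures.
From mathcomp Require Import all_boot all_order all_algebra.
From mathcomp Require Import all_classical all_reals all_analysis.

Set Implicit Arguments.
Unset Strict Implicit.
Unset Printing Implicit Defensive.

Import Order.TTheory GRing.Theory Num.Theory.
Import numFieldNormedType.Exports.

Local Open Scope classical_set_scope.
Local Open Scope ring_scope.

Section tuple_lebesgue_measure.
Variable R : realType.
Local Notation mR := (measurableTypeR R).

Section lebesgue_cons.
Variables (m : nat) (mu : {sigma_finite_measure set (m.-tuple mR) -> \bar R}).

Definition tuple_cons (xt : mR * m.-tuple mR) : m.+1.-tuple mR :=
  [tuple of xt.1 :: xt.2].

Lemma measurable_tuple_cons : measurable_fun [set: mR * m.-tuple mR] tuple_cons.
Proof. by apply: measurable_cons. Qed.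

Definition tuple_uncons (t : m.+1.-tuple mR) : mR * m.-tuple mR :=
  (thead t, [tuple of behead t]).

Lemma tuple_consK : cancel tuple_cons tuple_uncons.
Proof.
by case=> x t; rewrite /tuple_uncons /= theadE; congr pair; exact: val_inj.
Qed.

Lemma tuple_unconsK : cancel tuple_uncons tuple_cons.
Proof. by move=> t; rewrite /tuple_cons /= -tuple_eta. Qed.

Lemma measurable_tuple_uncons :
  measurable_fun [set: m.+1.-tuple mR] tuple_uncons.
Proof.
apply: measurable_fun_pair; first exact: measurable_tnth.
exact: measurable_behead.
Qed.

Definition lebesgue_cons : set (m.+1.-tuple mR) -> \bar R :=
  pushforward (lebesgue_measure \x mu)%E tuple_cons.

HB.instance Definition _ := Measure.copy lebesgue_cons
  (measure_function_pushforward__canonical__measure_function_Measure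
     (lebesgue_measure \x mu)%E measurable_tuple_cons).

Lemma lebesgue_cons_sigma_finite : sigma_finite setT lebesgue_cons.
Proof.
have /sigma_finiteP[F [FT ndF Foo]] := sigma_finiteT (@lebesgue_measure R).
have /sigma_finiteP[G [GT ndG Goo]] := sigma_finiteT mu.
exists (fun k => tuple_uncons @^-1` (F k `*` G k)) => [|k].
  apply/seteqP; split=> // t _ /=.
  have [i _ Fi] : (\bigcup_i F i) (tuple_uncons t).1 by rewrite -FT.
  have [j _ Gj] : (\bigcup_i G i) (tuple_uncons t).2 by rewrite -GT.
  exists (maxn i j) => //; split.
    by move: Fi; exact/subsetPset/ndF/leq_maxl.
  by move: Gj; exact/subsetPset/ndG/leq_maxr.
have [mF Fk] := Foo k; have [mG Gk] := Goo k; split.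
  rewrite -[X in measurable X]setTI.
  by apply: measurable_tuple_uncons => //; exact: measurableX.
rewrite /lebesgue_cons /pushforward -comp_preimage.
rewrite (_ : tuple_uncons \o tuple_cons = id); last exact/funext/tuple_consK.
rewrite preimage_id.
by rewrite product_measure1E// lte_mul_pinfty// ge0_fin_numE.
Qed.

HB.instance Definition _ := @Measure_isSigmaFinite.Build _ _ _
  lebesgue_cons lebesgue_cons_sigma_finite.

End lebesgue_cons.

(* Lebesgue measure on R^m, as the m-fold product of Lebesgue measure on R. *)
Fixpoint lebesgue_tuple m : {sigma_finite_measure set (m.-tuple mR) -> \bar R} :=
  if m is m'.+1 then lebesgue_cons (lebesgue_tuple m')
  else \d_([tuple] : 0.-tuple mR).

Lemma lebesgue_tuple_box m (a b : m.-tuple R) :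
  lebesgue_tuple m [set x | forall i, tnth x i \in `[tnth a i, tnth b i]]
  = (\prod_(i < m) lebesgue_measure (`[tnth a i, tnth b i] : set mR))%E.
Proof.
elim: m a b => [|m IH] a b.
  rewrite big_ord0 /= diracE mem_set//= => -[].
  by [].
rewrite big_ord_recl /= /lebesgue_cons /pushforward.
pose a' := [tuple of behead a]; pose b' := [tuple of behead b].
rewrite (_ : _ @^-1` _ = `[tnth a ord0, tnth b ord0] `*`
  [set x | forall i, tnth x i \in `[tnth a' i, tnth b' i]]).
  rewrite product_measure1E//.
  - rewrite IH; congr (_ * _)%E; apply: eq_bigr => i _.
    by rewrite [in RHS](tuple_eta a) [in RHS](tuple_eta b) !tnthS.
  - rewrite (_ : [set x | _] = \bigcap_(i in [set: 'I_m])
      ((fun x : m.-tuple mR => tnth x i) @^-1` `[tnth a' i, tnth b' i])).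
      apply: fin_bigcap_measurable => [|i _]; first exact: finite_finset.
      rewrite -[X in measurable X]setTI.
      by apply: measurable_tnth => //; exact: measurable_itv.
    by apply/seteqP; split=> x /= H i => [_|]; apply: H.
have tE (c : m.+1.-tuple R) i : tnth c (lift ord0 i) = tnth [tuple of behead c] i.
  by rewrite [in LHS](tuple_eta c) tnthS.
apply/seteqP; split=> -[x t];
  have xtE i : tnth (tuple_cons (x, t)) (lift ord0 i) = tnth t i by exact: tnthS.
  move=> H; split; first exact: (H ord0).
  by move=> i; have := H (lift ord0 i); rewrite xtE !tE.
move=> [Hx Ht] i; have [j ->|->//] := unliftP ord0 i.
by rewrite xtE !tE; exact: Ht.
Qed.

End tuple_lebesgue_measure.

(* Index set of the coordinates (gamma_ij), i <= j. *)
Definition le_pairs (n : nat) : {set 'I_n * 'I_n} :=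
  [set ij : 'I_n * 'I_n | (ij.1 <= ij.2)%N]%SET.

Lemma card_le_pairs n : #|le_pairs n| = (n * n.+1)./2.
Proof.
rewrite -sum1_card (eq_bigl (fun ij : 'I_n * 'I_n => (ij.1 <= ij.2)%N)); last first.
  by move=> ij; rewrite inE.
rewrite -(pair_big_dep xpredT (fun i j : 'I_n => (i <= j)%N) (fun _ _ => 1%N)).
rewrite (exchange_big_dep xpredT)//=.
under eq_bigr => j _.
  rewrite -(big_ord_widen n (fun=> 1%N) (ltn_ord j)) sum_nat_const card_ord muln1.
  over.
rewrite -(big_mkord xpredT (fun i => i.+1)) -(big_add1 _ _ 0 n.+1 xpredT id) /=.
have := bin2_sum n.+1; rewrite big_ltn// add0n => ->.
by rewrite bin2 mulnC.
Qed.

Section scalar_products.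
Variables (R : realType) (V : vectType R).

(* Real-valued functions of two vectors, with the topology of pointwise
   convergence: on the finite-dimensional subspace of (symmetric) bilinear forms
   it is the only Hausdorff vector space topology. *)
Definition forms := {ptws V -> {ptws V -> R}}.

Definition bilinear_form (g : forms) : Prop :=
  (forall x, scalar (g x)) /\ (forall y, scalar (fun x => g x y)).

Definition scalar_product (g : forms) : Prop :=
  [/\ bilinear_form g, (forall x y, g x y = g y x)
    & forall x, (forall y, g x y = 0) -> x = 0].

Definition has_signature (p p' : nat) (g : forms) : Prop :=
  exists e : (\dim {:V}).-tuple V,
    [/\ basis_of {:V} e,
        forall i j, i != j -> g (tnth e i) (tnth e j) = 0,
        forall i, g (tnth e i) (tnth e i) = 1 \/ g (tnth e i) (tnth e i) = - 1,
        #|[pred i | g (tnth e i) (tnth e i) == 1]| = p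
      & #|[pred i | g (tnth e i) (tnth e i) == - 1]| = p'].

Definition scalar_products (p p' : nat) : set forms :=
  [set g | scalar_product g /\ has_signature p p' g].

Lemma scalar_products_nonempty p p' :
  (p + p' = \dim {:V})%N -> exists g, scalar_products p p' g.
Proof.
move=> h.
pose e := vbasis {:V}.
have be : basis_of {:V} e := vbasisP _.
pose s (i : 'I_(\dim {:V})) : R := if (i < p)%N then 1 else -1.
pose g : forms := fun x y => \sum_i s i * (coord e i x * coord e i y).
have ge i j : g (tnth e i) (tnth e j) = s i * (i == j)%:R.
  have fe : free e := basis_free be.
  rewrite /g (bigD1 i)//= !(tnth_nth 0) !coord_free// eqxx mul1r.
  rewrite big1 ?addr0 ?(eq_sym j)// => k ki.
  by rewrite coord_free// eq_sym (negbTE ki) mul0r mulr0.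
have gx i x : g (tnth e i) x = s i * coord e i x.
  have fe : free e := basis_free be.
  rewrite /g (bigD1 i)//= (tnth_nth 0) coord_free// eqxx mul1r.
  rewrite big1 ?addr0// => k ki.
  by rewrite coord_free// eq_sym (negbTE ki) mul0r mulr0.
have gC x y : g x y = g y x.
  by apply: eq_bigr => i _; rewrite (mulrC (coord e i x)).
have gl x : scalar (g x).
  move=> a u v; rewrite /g mulr_sumr -big_split/=; apply: eq_bigr => i _.
  by rewrite linearP/= mulrDr mulrDr !mulrA (mulrC _ a) !mulrA.
have s_neq0 i : s i != 0 by rewrite /s; case: ifP; rewrite ?oppr_eq0 oner_eq0.
exists g; split; first split=> //.
- split=> // y a u v; have := gl y a u v.
  by rewrite (gC _ y) (gC u y) (gC v y).
- move=> x gx0; rewrite (coord_basis be (memvf x)) big1// => i _.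
  have := gx0 (tnth e i); rewrite gC gx => /eqP.
  by rewrite mulf_eq0 (negbTE (s_neq0 i))/= => /eqP ->; rewrite scale0r.
- have N1 : (-1 == 1 :> R) = false.
    by apply/negbTE; rewrite lt_eqF// (lt_trans (ltrN10 R)).
  pose A : {set 'I_(\dim {:V})} := [set i : 'I__ | (i < p)%N]%SET.
  have cardA : #|A| = p.
    rewrite -sum1_card (eq_bigl (fun i : 'I__ => (i < p)%N)); last first.
      by move=> i; rewrite inE.
    rewrite -(big_ord_widen (\dim {:V}) (fun=> 1%N)) -?h ?leq_addr//.
    by rewrite sum_nat_const card_ord muln1.
  exists e; split=> //.
  + by move=> i j ij; rewrite ge (negbTE ij) mulr0.
  + by move=> i; rewrite ge eqxx mulr1 /s; case: ifP => _; [left|right].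
  + rewrite -[RHS]cardA; apply: eq_card => i; rewrite /A !inE ge eqxx mulr1 /s.
    by case: ifP => // _; rewrite ?eqxx ?N1.
  + have <- : #|(~: A)%SET| = p' by rewrite cardsCs finset.setCK cardA card_ord -h addKn.
    apply: eq_card => i; rewrite /A !inE ge eqxx mulr1 /s.
    by case: ifP => // _; rewrite ?eqxx// eq_sym N1.
Qed.

(* The manifold Gamma, with the topology induced by forms. The argument h only
   serves to make the type pointed, as measurable types have to be. *)
Definition Gamma p p' (h : (p + p' = \dim {:V})%N) : Type :=
  set_type (scalar_products p p').

End scalar_products.

HB.instance Definition _ (R : realType) (V : vectType R) p p'
    (h : (p + p' = \dim {:V})%N) :=
  Topological.copy (Gamma h) (set_type (@scalar_products R V p p')).

HB.instance Definition _ (R : realType) (V : vectType R) p p'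
    (h : (p + p' = \dim {:V})%N) :=
  isPointed.Build (Gamma h)
    (exist (fun g => g \in @scalar_products R V p p') _
       (mem_set (projT2 (cid (scalar_products_nonempty h))))).

Section natural_measure.
Variables (R : realType) (V : vectType R).
Variables (p p' : nat) (h : (p + p' = \dim {:V})%N).

Definition form_of (g : Gamma h) : V -> V -> R := sval g.

(* Gamma with its Borel sigma-algebra. *)
Definition borel_Gamma := g_sigma_algebraType (@open (Gamma h)).

Definition regular_borel (mu : {measure set borel_Gamma -> \bar R}) : Prop :=
  [/\ forall K : set (Gamma h), compact K -> (mu K < +oo)%E,
      forall A : set borel_Gamma, measurable A ->
        mu A = ereal_inf
          [set mu U | U in [set U : set (Gamma h) | open U /\ A `<=` U]]
    & forall A : set borel_Gamma, measurable A ->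
        mu A = ereal_sup
          [set mu K | K in [set K : set (Gamma h) | compact K /\ K `<=` A]]].

(* GL(V): a linear endomorphism of V is invertible iff its kernel is trivial. *)
Definition GL : Type := {g : 'End(V) | lker g == 0%VS}.

Lemma GL_act_subproof (g : GL) (x : Gamma h) :
  ((fun v w => form_of x ((\val g)^-1%VF v) ((\val g)^-1%VF w)) : forms V)
    \in @scalar_products R V p p'.
Proof.
case: g x => g kg [x x_in]; rewrite /form_of /=; have /set_mem xS := x_in.
have [[[xl xr] xC x_nd] [e [be e_orth e_sq e_p e_p']]] := xS.
have gK := lker0_lfunK kg; have gVK := lker0_lfunVK kg.
apply/mem_set; split; first split.
- split=> [u a y z|u a y z]; first by rewrite linearP; exact: xl.
  by rewrite linearP; exact: xr.
- by move=> u w; exact: xC.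
- move=> u ux0; rewrite -(gVK u) (x_nd (g^-1%VF u)) ?linear0// => w.
  by rewrite -(gK w).
have ex i j : x (g^-1%VF (tnth (map_tuple g e) i))
                (g^-1%VF (tnth (map_tuple g e) j))
    = x (tnth e i) (tnth e j) by rewrite !tnth_map !gK.
exists (map_tuple g e); split.
- have /(@limg_basis_of _ _ _ g fullv e) : (fullv :&: lker g = 0)%VS.
    by apply/eqP; rewrite -subv0 -(eqP kg) capvSr.
  by rewrite (lker0_limgf kg); exact.
- by move=> i j ij; rewrite ex e_orth.
- by move=> i; rewrite ex; exact: e_sq.
- by rewrite -e_p; apply: eq_card => i; rewrite !inE ex.
- by rewrite -e_p'; apply: eq_card => i; rewrite !inE ex.
Qed.

(* (g x)(v, w) = x(g^-1 v, g^-1 w) *)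
Definition GL_act (g : GL) (x : Gamma h) : Gamma h :=
  exist (fun g => g \in @scalar_products R V p p') _ (GL_act_subproof g x).

Section coordinates.
Variable v : (\dim {:V}).-tuple V.
Local Notation n := (\dim {:V}).
Local Notation N := #|le_pairs n|.

Definition gram (g : V -> V -> R) : 'M[R]_n :=
  \matrix_(i, j) g (tnth v i) (tnth v j).

(* The coordinate map phi. *)
Definition coords (g : Gamma h) : N.-tuple R :=
  [tuple gram (form_of g) (enum_val I).1 (enum_val I).2 | I < N].

(* Q = gamma^ik gamma^jl dgamma_ij (x) dgamma_kl at the point g of Gamma, applied
   to the tangent vectors a and b (symmetric bilinear forms on V). *)
Definition natural_metric (g : Gamma h) (a b : V -> V -> R) : R :=
  \sum_i \sum_j \sum_k \sum_l
    invmx (gram (form_of g)) i k * invmx (gram (form_of g)) j l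
      * (gram a i j * gram b k l).

(* The coordinate vector field of index I: the symmetric bilinear form whose
   I-th coordinate is 1 and whose other coordinates are 0. *)
Definition coord_vector (I : 'I_N) (x y : V) : R :=
  let: (i, j) := enum_val I in
  if i == j then coord v i x * coord v j y
  else coord v i x * coord v j y + coord v j x * coord v i y.

Lemma coord_vectorE (I J : 'I_N) : basis_of {:V} v ->
  gram (coord_vector I) (enum_val J).1 (enum_val J).2 = (I == J)%:R.
Proof.
move=> /basis_free fv; rewrite /coord_vector !mxE -(inj_eq enum_val_inj).
have := enum_valP I; have := enum_valP J.
case: (enum_val I) (enum_val J) => i j [k l]; rewrite !inE /= => kl ij.
rewrite !(tnth_nth 0) xpair_eqE; have [<-|ne] := eqVneq i j.
  by rewrite !coord_free// -natrM mulnb !(eq_sym i).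
rewrite !coord_free// -!natrM !mulnb -natrD !(eq_sym _ k) !(eq_sym _ l).
have [ki|_] := eqVneq k i; have [lj|_] := eqVneq l j;
  have [kj|_] := eqVneq k j; have [li|_] := eqVneq l i => //=; subst.
all: by case/eqP: ne; apply/val_inj/anti_leq; rewrite ?ij ?kl.
Qed.

Definition metric_components (g : Gamma h) : 'M[R]_N :=
  \matrix_(I, J) natural_metric g (coord_vector I) (coord_vector J).

(* mu is the regular Borel measure d mu_Q determined by the basis v. The map
   pinv setT coords is the inverse of coords on its range. *)
Definition natural_measure_spec (mu : {measure set borel_Gamma -> \bar R}) : Prop :=
  regular_borel mu /\
  forall f : Gamma h -> R, continuous f -> compact (closure [set g | f g != 0]) ->
    (\int[mu]_g (f g)%:E =
     \int[lebesgue_tuple R N]_(x in range coords)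
       (((fun g => f g * Num.sqrt `|\det (metric_components g)|)
          \o pinv [set: Gamma h] coords) x)%:E)%E.

End coordinates.
End natural_measure.

(* Main.v *)
Require Import Defs.
From HB Require Import structures.
From mathcomp Require Import all_boot all_order all_algebra.
From mathcomp Require Import all_classical all_reals all_analysis.
From mathcomp Require Import measurable_realfun ring lra.

(** Writing [phi_v] for the coordinates of a basis [v], the measure [mu_Q] is
    [A |-> \int_(phi_v A) sqrt |det Q_IJ|], a locally finite Borel measure on a
    space homeomorphic to an open subset of [R^N], hence regular.

    If [w = P v], then [phi_w = L phi_v] for a linear map [L] of [R^N], and
    [Q_IJ] for [v] is [L^T Q_IJ' L] with [Q_IJ'] the components for [w]: the factor
    [|det L|] in the densities is the one of the change of variables [x |-> L x],
    so the two integrals of a function agree. An inner regular measure is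
    controlled on open sets by its integrals of compactly supported functions,
    and an outer regular one by its values on open sets; this gives the
    independence of the basis.

    Finally [phi_(g v) (g x) = phi_v x], and likewise for the components of [Q], so
    pushing forward by [g] amounts to replacing the basis [v] by [g v]. *)

Set Implicit Arguments.
Unset Strict Implicit.
Unset Printing Implicit Defensive.

Import Order.TTheory GRing.Theory Num.Theory.
Import numFieldNormedType.Exports.

Local Open Scope classical_set_scope.
Local Open Scope ring_scope.

(** * Linear change of variables for Lebesgue measure *)

Section linear_change_of_variables.
Context {R : realType}.
Local Notation mR := (measurableTypeR R).
Local Notation leb := (@lebesgue_measure R).

(** That the coordinates identify [Gamma] with an open subset of [R^N] rests on the stability of the
    signature. In a basis orthonormal for a given form, the Gram matrix of a nearby form is close to
    a diagonal matrix of signs, and elimination with explicit error bounds brings it to exactly that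
    matrix by a congruence. The change of variables is proved for nonnegative measurable functions
    only, by factoring the matrix into block triangular ones that Tonelli reduces to affine maps of
    one variable. The determinant of [L] is never evaluated: [Q] is unchanged when its base point
    and both arguments undergo the same congruence, so the ratio of the densities comes out as
    [|det L|] itself. Comparing two measures on an open set through bump functions uses the inner
    regularity of the smaller one and only the integrals of the other. Hence the pushforward by [g]
    is never shown to be regular: the inequality for [g] and the one for its inverse give equality
    on open sets, and the outer regularity of the original measure does the rest. *)

Definition affine (a b : R) : mR -> mR := fun x => a * x + b.

Lemma measurable_affine (a b : R) :
  measurable_fun [set: mR] (affine a b).
Proof.
apply: (measurable_funD (f := fun x : R => a * x) (g := cst b)) => //.
exact: (measurable_funM (f := cst a) (g := id)).
Qed.

(** Lebesgue measure is determined by its values on half-open intervals, so the rescaled image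
    measure only has to be computed there. *)
Lemma lebesgue_measure_affine (a b : R) (A : set mR) : a != 0 -> measurable A ->
  (`|a|%:E * leb ((affine a b) @^-1` A) = leb A)%E.
Proof.
move=> a0; move: A; pose k : {nonneg R} := NngNum (normr_ge0 a).
have maff := measurable_affine a b.
pose m1 : {measure set mR -> \bar R} :=
  measure_function_pushforward__canonical__measure_function_Measure leb maff.
move=> A mA; suff H : forall B, ocitv B -> leb B = mscale k m1 B.
  by apply/esym; have := @lebesgue_measure_unique R (mscale k m1) H _ mA.
move=> _ [[c d]] _ <-.
rewrite /mscale /= /pushforward /= /affine.
have [a_gt0|a_lt0|/eqP] := ltgtP 0 a; last by rewrite eq_sym (negbTE a0).
- rewrite (_ : _ @^-1` _ = `](c - b) / a, (d - b) / a]%classic); last first.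
    apply/seteqP; split => x /=; rewrite !in_itv /=.
    by rewrite ltr_pdivrMr// ler_pdivlMr// ltrBlDr lerBrDr mulrC.
    by rewrite ltr_pdivrMr// ler_pdivlMr// ltrBlDr lerBrDr mulrC.
  rewrite !lebesgue_measure_itv /= !lte_fin ltr_pM2r ?invr_gt0// ltrD2r.
  case: ifPn => _; last by rewrite mule0.
  rewrite -!EFinB -EFinM gtr0_norm//; congr (_%:E).
  by field.
(* For [a < 0] the endpoints are exchanged and the preimage is closed on the left instead of the
   right; its length is the same. *)
- rewrite (_ : _ @^-1` _ = `[(d - b) / a, (c - b) / a[%classic); last first.
    by apply/seteqP; split => x /=; rewrite !in_itv /=;
      rewrite ltr_ndivlMr// ler_ndivrMr// ltrBlDr lerBrDr mulrC andbC.
  rewrite !lebesgue_measure_itv /= !lte_fin ltr_nM2r ?invr_lt0// ltrD2r.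
  case: ifPn => _; last by rewrite mule0.
  rewrite -!EFinB -EFinM ltr0_norm//; congr (_%:E).
  by field.
Qed.

Lemma ge0_integral_affine (a b : R) (f : mR -> \bar R) : a != 0 ->
  measurable_fun [set: mR] f -> (forall x, 0 <= f x)%E ->
  (`|a|%:E * \int[leb]_x f (affine a b x) = \int[leb]_x f x)%E.
Proof.
move=> a0 mf f0; pose k : {nonneg R} := NngNum (normr_ge0 a).
have maff := measurable_affine a b.
pose m1 : {measure set mR -> \bar R} :=
  measure_function_pushforward__canonical__measure_function_Measure leb maff.
rewrite [RHS](eq_measure_integral (mscale k m1)); last first.
  by move=> A mA _; exact/esym/(lebesgue_measure_affine b a0 mA).
rewrite ge0_integral_mscale//=; congr (_ * _)%E.
by rewrite ge0_integral_pushforward//; exact: measurable_affine.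
Qed.

Section tuple_step.
Variables (m : nat) (f : m.+1.-tuple mR -> \bar R).
Hypotheses (mf : measurable_fun setT f) (f0 : forall x, (0 <= f x)%E).

Let mfc : measurable_fun setT (f \o @tuple_cons R m).
Proof. by apply: measurableT_comp => //; exact: measurable_tuple_cons. Qed.

Lemma ge0_integral_lebesgue_cons :
  (\int[lebesgue_tuple R m.+1]_x f x =
   \int[leb]_x \int[lebesgue_tuple R m]_t f (tuple_cons (x, t)))%E.
Proof.
rewrite [LHS]ge0_integral_pushforward//; last exact: measurable_tuple_cons.
by rewrite fubini_tonelli1// => x; exact: f0.
Qed.

(** Integrating the head first suits maps that act on the head by an affine function depending on
    the tail; the other order suits maps that move the tail in a way depending on the head. *)
Lemma ge0_integral_lebesgue_cons_swap :
  (\int[lebesgue_tuple R m.+1]_x f x =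
   \int[lebesgue_tuple R m]_t \int[leb]_x f (tuple_cons (x, t)))%E.
Proof.
rewrite [LHS]ge0_integral_pushforward//; last exact: measurable_tuple_cons.
by rewrite fubini_tonelli2// => x; exact: f0.
Qed.

End tuple_step.

Definition linear_tuple m (M : 'M[R]_m) (t : m.-tuple mR) : m.-tuple mR :=
  [tuple \sum_j M i j * tnth t j | i < m].

Definition translate_tuple m (u t : m.-tuple mR) : m.-tuple mR :=
  [tuple tnth t i + tnth u i | i < m].

Lemma measurable_linear_tuple m (M : 'M[R]_m) :
  measurable_fun setT (linear_tuple M).
Proof.
apply/measurable_fun_tnthP => i.
rewrite (_ : _ \o _ = (fun t : m.-tuple mR => \sum_j M i j * tnth t j : mR)); last first.
  by apply/funext => t; rewrite /= tnth_mktuple.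
apply: measurable_sum => j.
apply: (measurable_funM (f := cst (M i j))
  (g := fun t : m.-tuple mR => tnth t j : R)) => //.
exact: measurable_tnth.
Qed.

Lemma measurable_translate_tuple m (u : m.-tuple mR) :
  measurable_fun setT (translate_tuple u).
Proof.
apply/measurable_fun_tnthP => i.
rewrite (_ : _ \o _ = (fun t : m.-tuple mR => tnth t i + tnth u i : mR)); last first.
  by apply/funext => t; rewrite /= tnth_mktuple.
apply: (measurable_funD (f := fun t : m.-tuple mR => tnth t i : R)
  (g := cst (tnth u i : R))) => //.
exact: measurable_tnth.
Qed.

Lemma tnth_tuple_cons0 m (xt : mR * m.-tuple mR) : tnth (tuple_cons xt) ord0 = xt.1.
Proof. by []. Qed.

Lemma tnth_tuple_consS m (xt : mR * m.-tuple mR) i :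
  tnth (tuple_cons xt) (lift ord0 i) = tnth xt.2 i.
Proof. exact: tnthS. Qed.

Lemma translate_tuple_cons m (u : m.+1.-tuple mR) (x : mR) (t : m.-tuple mR) :
  translate_tuple u (tuple_cons (x, t)) =
  tuple_cons (affine 1 (tnth u ord0) x, translate_tuple [tuple of behead u] t).
Proof.
apply: eq_from_tnth => i; rewrite tnth_mktuple.
have [j ->|->] := unliftP ord0 i.
  rewrite !tnth_tuple_consS /= tnth_mktuple; congr (_ + _).
  by rewrite [in LHS](tuple_eta u) tnthS.
by rewrite !tnth_tuple_cons0 /= /affine mul1r.
Qed.

(** One variable at a time, by Tonelli. Lower shears will be translations of the tail once the head
    is fixed. *)
Lemma ge0_integral_translate m (u : m.-tuple mR) (f : m.-tuple mR -> \bar R) :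
  measurable_fun setT f -> (forall t, 0 <= f t)%E ->
  (\int[lebesgue_tuple R m]_t f (translate_tuple u t) =
   \int[lebesgue_tuple R m]_t f t)%E.
Proof.
elim: m u f => [|m IH] u f mf f0.
  apply: eq_integral => t _; congr f; apply: eq_from_tnth => -[] //.
rewrite ge0_integral_lebesgue_cons//; last first.
  by apply: measurableT_comp => //; exact: measurable_translate_tuple.
under eq_integral do under eq_integral do rewrite translate_tuple_cons.
have mfc : measurable_fun setT (f \o @tuple_cons R m).
  by apply: measurableT_comp => //; exact: measurable_tuple_cons.
under eq_integral => x _.
  rewrite (IH _ (fun t => f (tuple_cons (affine 1 (tnth u ord0) x, t))))//; last first.
    apply: (measurableT_comp mfc).
    exact: pair1_measurable.
  over.
have := @ge0_integral_affine 1 (tnth u ord0)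
  (fun x => \int[lebesgue_tuple R m]_t f (tuple_cons (x, t)))%E.
rewrite normr1 mul1e => ->//.
- by rewrite -ge0_integral_lebesgue_cons.
- by apply: (measurable_fun_fubini_tonelli_F (f \o @tuple_cons R m)) => // x; exact: f0.
- by move=> x; apply: integral_ge0.
Qed.

(** With [|det M|] kept as a factor and nonnegative functions only, the property passes to products
    of matrices without any integrability condition. *)
Definition scales_lebesgue m (M : 'M[R]_m) := forall f : m.-tuple mR -> \bar R,
  measurable_fun setT f -> (forall t, 0 <= f t)%E ->
  (`|\det M|%:E * \int[lebesgue_tuple R m]_t f (linear_tuple M t) =
   \int[lebesgue_tuple R m]_t f t)%E.

Lemma linear_tupleM m (M N : 'M[R]_m) t :
  linear_tuple (M *m N) t = linear_tuple M (linear_tuple N t).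
Proof.
apply: eq_from_tnth => i; rewrite !tnth_mktuple.
under eq_bigr do rewrite mxE big_distrl /=.
rewrite exchange_big /=; apply: eq_bigr => j _; rewrite tnth_mktuple big_distrr /=.
by apply: eq_bigr => k _; rewrite mulrA.
Qed.

Lemma linear_tuple1 m (t : m.-tuple mR) : linear_tuple 1%:M t = t.
Proof.
apply: eq_from_tnth => i; rewrite tnth_mktuple (bigD1 i)//= mxE eqxx mul1r.
by rewrite big1 ?addr0// => j ji; rewrite mxE eq_sym (negbTE ji) mul0r.
Qed.

Lemma scales_lebesgueM m (M N : 'M[R]_m) :
  scales_lebesgue M -> scales_lebesgue N -> scales_lebesgue (M *m N).
Proof.
move=> hM hN f mf f0; under eq_integral do rewrite linear_tupleM.
rewrite det_mulmx normrM EFinM -muleA (hN (f \o linear_tuple M)) ?hM//.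
- by apply: measurableT_comp => //; exact: measurable_linear_tuple.
- by move=> t; exact: f0.
Qed.

Lemma scales_lebesgue1 m : scales_lebesgue (1%:M : 'M[R]_m).
Proof.
by move=> f mf f0; under eq_integral do rewrite linear_tuple1;
  rewrite det1 normr1 mul1e.
Qed.

(** For a fixed tail the head undergoes an affine map of slope [a] whose offset depends on the tail;
    integrating it out leaves [D] acting on the tail alone. *)
Lemma scales_lebesgue_upper m (a : R) (b : 'rV[R]_m) (D : 'M[R]_m) : a != 0 ->
  scales_lebesgue D -> scales_lebesgue (block_mx a%:M b 0 D : 'M[R]_(1 + m)).
Proof.
move=> a0 hD f mf f0.
have lE x t : linear_tuple (block_mx a%:M b 0 D : 'M[R]_(1 + m)) (tuple_cons (x, t)) =
    tuple_cons (affine a (\sum_j b 0 j * tnth t j) x, linear_tuple D t).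
  apply: eq_from_tnth => i; rewrite tnth_mktuple (@big_split_ord _ _ _ 1 m) /= big_ord1.
  have Er (j : 'I_m) : tnth (tuple_cons (x, t)) (rshift 1 j) = tnth t j.
    by rewrite (_ : rshift 1 j = lift ord0 j) ?tnth_tuple_consS//; exact: val_inj.
  under eq_bigr do rewrite Er.
  rewrite (_ : @lshift 1 m ord0 = ord0) ?tnth_tuple_cons0; last exact: val_inj.
  have [j ->|->] := unliftP ord0 i.
    rewrite tnth_tuple_consS /= tnth_mktuple.
    rewrite (_ : lift ord0 j = rshift 1 j); last exact: val_inj.
    rewrite (_ : @ord0 m = @lshift 1 m ord0); last exact: val_inj.
    rewrite block_mxEdl mxE mul0r add0r.
    by apply: eq_bigr => k _; rewrite block_mxEdr.
  rewrite tnth_tuple_cons0 /= /affine (_ : @ord0 m = @lshift 1 m ord0); last exact: val_inj.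
  rewrite block_mxEul mxE eqxx mulr1n; congr (_ + _).
  by apply: eq_bigr => k _; rewrite block_mxEur.
have mfc : measurable_fun setT (f \o @tuple_cons R m).
  by apply: measurableT_comp => //; exact: measurable_tuple_cons.
rewrite ge0_integral_lebesgue_cons_swap//; last first.
  by apply: measurableT_comp => //; exact: measurable_linear_tuple.
rewrite (@det_ublock _ 1 m) det_scalar1 normrM EFinM (muleC `|a|%:E) -muleA.
rewrite -ge0_integralZl//; last 2 first.
- apply: (measurable_fun_fubini_tonelli_G
    (f \o linear_tuple (block_mx a%:M b 0 D : 'M[R]_(1 + m)) \o @tuple_cons R m)).
    apply: measurableT_comp; last exact: measurable_tuple_cons.
    by apply: measurableT_comp => //; exact: measurable_linear_tuple.
  by move=> x; exact: f0.
- by move=> t _; apply: integral_ge0.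
under eq_integral => t _.
  under eq_integral do rewrite lE.
  rewrite (ge0_integral_affine _ (f := fun x => f (tuple_cons (x, linear_tuple D t))))//; last first.
    apply: (measurableT_comp mfc).
    exact: pair2_measurable.
  over.
rewrite (hD (fun t => \int[leb]_x f (tuple_cons (x, t)))%E)/=.
- by rewrite -ge0_integral_lebesgue_cons_swap.
- by apply: (measurable_fun_fubini_tonelli_G (f \o @tuple_cons R m)) => // x; exact: f0.
- by move=> t; apply: integral_ge0.
Qed.

(** For a fixed head the tail is merely translated by a multiple of [s], and the determinant is
    one. *)
Lemma scales_lebesgue_lower m (s : 'cV[R]_m) :
  scales_lebesgue (block_mx 1%:M 0 s 1%:M : 'M[R]_(1 + m)).
Proof.
move=> f mf f0.
have lE x t : linear_tuple (block_mx 1%:M 0 s 1%:M : 'M[R]_(1 + m)) (tuple_cons (x, t)) =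
    tuple_cons (x, translate_tuple [tuple s i 0 * x | i < m] t).
  apply: eq_from_tnth => i; rewrite tnth_mktuple (@big_split_ord _ _ _ 1 m) /= big_ord1.
  have Er (j : 'I_m) : tnth (tuple_cons (x, t)) (rshift 1 j) = tnth t j.
    by rewrite (_ : rshift 1 j = lift ord0 j) ?tnth_tuple_consS//; exact: val_inj.
  under eq_bigr do rewrite Er.
  rewrite (_ : @lshift 1 m ord0 = ord0) ?tnth_tuple_cons0; last exact: val_inj.
  have [j ->|->] := unliftP ord0 i.
    rewrite tnth_tuple_consS /= !tnth_mktuple.
    rewrite (_ : lift ord0 j = rshift 1 j); last exact: val_inj.
    rewrite (_ : @ord0 m = @lshift 1 m ord0); last exact: val_inj.
    rewrite block_mxEdl (bigD1 j)//= block_mxEdr mxE eqxx mul1r.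
    rewrite big1 ?addr0 1?addrC// => k kj.
    by rewrite block_mxEdr mxE eq_sym (negbTE kj) mul0r.
  rewrite tnth_tuple_cons0 /= (_ : @ord0 m = @lshift 1 m ord0); last exact: val_inj.
  rewrite block_mxEul mxE eqxx mulr1n mul1r big1 ?addr0// => k _.
  by rewrite block_mxEur mxE mul0r.
have mfc : measurable_fun setT (f \o @tuple_cons R m).
  by apply: measurableT_comp => //; exact: measurable_tuple_cons.
rewrite (@det_lblock _ 1 m) !det1 mulr1 normr1 mul1e.
rewrite ge0_integral_lebesgue_cons//; last first.
  by apply: measurableT_comp => //; exact: measurable_linear_tuple.
rewrite [RHS]ge0_integral_lebesgue_cons//; apply: eq_integral => x _.
under eq_integral do rewrite lE.
rewrite (ge0_integral_translate _ (f := fun t => f (tuple_cons (x, t))))//.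
by apply: (measurableT_comp mfc); exact: pair1_measurable.
Qed.

(** Elimination with the pivot [a]: [M] is a lower shear times an upper block matrix with corner [a]
    and lower block the Schur complement [D], which is invertible because [det M = a * det D]. *)
Lemma scales_lebesgue_corner m (M : 'M[R]_(1 + m)) :
  (forall D : 'M[R]_m, D \in unitmx -> scales_lebesgue D) ->
  M \in unitmx -> ulsubmx M 0 0 != 0 -> scales_lebesgue M.
Proof.
move=> IH uM; set a := ulsubmx M 0 0 => a0.
pose s := a^-1 *: dlsubmx M.
pose D := drsubmx M - s *m ursubmx M.
have aE : ulsubmx M = a%:M.
  by apply/matrixP => i j; rewrite !ord1 [RHS]mxE eqxx mulr1n.
have ME : M = (block_mx 1%:M 0 s 1%:M : 'M[R]_(1 + m)) *m block_mx a%:M (ursubmx M) 0 D.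
  rewrite mulmx_block !mul1mx !mul0mx !addr0 /D addrC subrK.
  by rewrite -aE /s -scalemxAl aE mul_mx_scalar scalerA mulVf// scale1r -aE submxK.
rewrite ME; apply: scales_lebesgueM; first exact: scales_lebesgue_lower.
apply: scales_lebesgue_upper => //; apply: IH.
move: uM; rewrite ME unitmx_mul => /andP[_].
by rewrite !unitmxE (@det_ublock _ 1 m) unitrM => /andP[].
Qed.

(* A row operation moves a nonzero entry of the first column to the corner. *)
Theorem linear_change_of_variables m (M : 'M[R]_m) : M \in unitmx -> scales_lebesgue M.
Proof.
elim: m M => [M _|m IH].
  by rewrite (flatmx0 M) -(flatmx0 1%:M); exact: scales_lebesgue1.
change (forall M : 'M[R]_(1 + m), M \in unitmx -> scales_lebesgue M) => M uM.
have [a0|] := eqVneq (ulsubmx M 0 0) 0; last first.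
  exact: scales_lebesgue_corner.
have [i ci0] : exists i, dlsubmx M i 0 != 0.
  apply/not_existsP => c0; move: uM; rewrite unitmxE -(submxK M).
  rewrite (_ : ulsubmx _ = 0); last by apply/matrixP => i j; rewrite !ord1 a0 mxE.
  rewrite (_ : dlsubmx _ = 0); last first.
    apply/matrixP => i j; rewrite !ord1 [RHS]mxE.
    by have /negP := c0 i; rewrite negbK => /eqP.
  by rewrite (@det_ublock _ 1 m) det0 mul0r unitr0.
(* [T c] adds [c] times row [i] of the lower block to the first row. A shear is preferred to a swap
   because it is upper block triangular, and [T (- 1)] undoes [T 1]. *)
pose T (c : R) : 'M[R]_(1 + m) := block_mx 1%:M (c *: delta_mx 0 i) 0 1%:M.
have TE : M = T (- 1) *m (T 1 *m M).
  rewrite mulmxA mulmx_block !mul1mx !mulmx1 !mul0mx !mulmx0 !addr0 !add0r.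
  by rewrite scaleN1r scale1r addrN -scalar_mx_block mul1mx.
have hT c : scales_lebesgue (T c).
  apply: scales_lebesgue_upper; first exact: oner_neq0.
  exact: scales_lebesgue1.
rewrite TE; apply: scales_lebesgueM => //; apply: scales_lebesgue_corner => //.
  by rewrite unitmx_mul uM andbT unitmxE (@det_ublock _ 1 m) !det1 mulr1 unitr1.
rewrite /T -[X in _ *m X]submxK mulmx_block block_mxKul.
rewrite mul1mx mxE a0 add0r scale1r -rowE mxE //.
Qed.

End linear_change_of_variables.

(** * Regularity of Borel measures *)

Section measure_limits.
Context d (T : measurableType d) (R : realType) (mu : {measure set T -> \bar R}).
Local Open Scope ereal_scope.

Lemma measure_bigcup_gt (F : (set T)^nat) (y : \bar R) :
  (forall i, measurable (F i)) -> nondecreasing_seq F ->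
  y < mu (\bigcup_n F n) -> exists n, y < mu (F n).
Proof.
move=> mF ndF yF; apply: contrapT => /forallNP H.
have mU : measurable (\bigcup_n F n) by exact: bigcup_measurable.
have cF := nondecreasing_cvg_mu (mu := mu) mF mU ndF.
move: yF; rewrite -(cvg_lim _ cF)// ltNge => /negP; apply.
apply: lime_le; first by apply/cvg_ex; eexists; exact: cF.
by apply: nearW => n /=; rewrite leNgt; exact/negP/H.
Qed.

Lemma measure_bigcap_lt (F : (set T)^nat) (y : \bar R) : mu (F 0%N) < +oo ->
  (forall i, measurable (F i)) -> nonincreasing_seq F ->
  mu (\bigcap_n F n) < y -> exists n, mu (F n) < y.
Proof.
move=> F0 mF niF yF; apply: contrapT => /forallNP H.
have mU : measurable (\bigcap_n F n) by exact: bigcap_measurable.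
have cF := nonincreasing_cvg_mu (mu := mu) F0 mF mU niF.
move: yF; rewrite -(cvg_lim _ cF)// ltNge => /negP; apply.
apply: lime_ge; first by apply/cvg_ex; eexists; exact: cF.
by apply: nearW => n /=; rewrite leNgt; exact/negP/H.
Qed.

Lemma measure_bigcup_geometric (F : (set T)^nat) (e : R) : (0 <= e)%R ->
  (forall i, measurable (F i)) -> (forall i, mu (F i) <= (e / (2 ^ i.+1)%:R)%:E) ->
  mu (\bigcup_n F n) <= e%:E.
Proof.
move=> e0 mF Fe; apply: (@le_trans _ _ (\sum_(0 <= i <oo) mu (F i))).
  by apply: measure_sigma_subadditive => //; exact: bigcup_measurable.
apply: le_trans (epsilon_trick0 xpredT e0).
by apply: lee_nneseries => // i _ _; exact: Fe.
Qed.

End measure_limits.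

Section borel_regularity.
Context {R : realType} {T : ptopologicalType}.
Local Notation bT := (g_sigma_algebraType (@open T)).
Variable mu : {measure set bT -> \bar R}.
Local Open Scope ereal_scope.

Lemma borel_open (U : set T) : open U -> measurable (U : set bT).
Proof. exact: sub_sigma_algebra. Qed.

Lemma borel_closed (F : set T) : closed F -> measurable (F : set bT).
Proof.
by move=> cF; rewrite -(setCK F); apply: measurableC; apply: borel_open; exact: closed_openC.
Qed.

(** The sets approximable in this way form a sigma-algebra containing the open sets. Cutting by [V],
    of finite measure, gives access to continuity from above, used both for open sets and for
    countable unions. *)
Lemma closed_open_approx (V : set T) : open V -> mu V < +oo ->
  (forall U : set T, open U -> exists C : (set T)^nat,
     (forall i, closed (C i)) /\ U = \bigcup_i C i) ->
  forall A : set bT, measurable A -> forall e : R, (0 < e)%R ->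
  exists F U : set T,
    [/\ closed F, open U, F `<=` A, A `<=` U & mu ((U `\` F) `&` V) < e%:E].
Proof.
move=> oV Voo hF; have mV := borel_open oV.
have mFU (F U : set T) : closed F -> open U -> measurable ((U `\` F) `&` V : set bT).
  move=> cF oU; apply: measurableI => //; apply: measurableD.
    exact: borel_open. exact: borel_closed.
have Vlt (A : set bT) : measurable A -> mu (A `&` V) < +oo.
  by move=> mA; apply: le_lt_trans Voo; apply: le_measure; rewrite ?inE//; exact: measurableI.
apply: smallest_sub => [|U oU e e0].
  split=> [e e0|A hA e e0|A hA e e0].
  - exists set0, set0; split=> //; first exact: closed0; first exact: open0.
    by rewrite set0D set0I measure0 lte_fin.
  - have [F [U [cF oU FA AU lt_e]]] := hA _ e0.
    exists (~` U), (~` F); split; [exact: open_closedC|exact: closed_openC| | |].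
    + by rewrite setTD; exact: subsetC.
    + by rewrite setTD; exact: subsetC.
    + by rewrite (_ : ~` F `\` ~` U = U `\` F)// !setDE setCK setIC.
  (* A countable union of closed sets need not be closed. Half of [e] is shared out among the sets
     [A i]; the other half is the slack for truncating the union of the [F i] to a finite one. *)
  - have e2 i : (0 < e / 2 / (2 ^ i.+1)%:R)%R by rewrite !divr_gt0// ltr0n expn_gt0.
    have /choice[F /choice[U FU]] i := hA i _ (e2 i).
    pose W := \bigcup_i U i.
    have oW : open W by apply: bigcup_open => i _; have [] := FU i.
    pose P n := \bigcup_(i < n) F i.
    have cP n : closed (P n).
      by apply: closed_bigcup => [|i _]; [exact: finite_II|have [] := FU i].
    have [||||n lt_e] := @measure_bigcap_lt _ _ _ mu (fun n => (W `\` P n) `&` V) e%:E.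
    + by apply: Vlt; apply: measurableD; [exact: borel_open|exact: borel_closed].
    + by move=> i; exact: mFU.
    + move=> m n mn; apply/subsetPset => x [[Wx nPx] Vx]; split=> //; split=> // -[i im Fi].
      by apply: nPx; exists i => //=; exact: leq_trans im mn.
    + apply: (@le_lt_trans _ _ (e / 2)%:E); last by rewrite lte_fin; lra.
      apply: (@le_trans _ _ (mu (\bigcup_i ((U i `\` F i) `&` V)))).
        apply: le_measure; rewrite ?inE.
        * by apply: bigcap_measurable => // i _; exact: mFU.
        * by apply: bigcup_measurable => i _; apply: mFU; have [] := FU i.
        * move=> x H; have [[[i _ Ui] _] Vx] := H 0%N I; exists i => //; split=> //.
          by split=> // Fi; have [[_ []]] := H i.+1 I; exists i => /=.
      apply: measure_bigcup_geometric => [|i|i]; first by rewrite divr_ge0// ltW.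
        by apply: mFU; have [] := FU i.
      by apply: ltW; have [] := FU i.
    exists (P n), W; split=> //.
    + by move=> x [i _ Fi]; exists i => //; have [_ _ s _ _] := FU i; exact: s.
    + by move=> x [i _ Ai]; exists i => //; have [_ _ _ s _] := FU i; exact: s.
have [C [cC UC]] := hF _ oU.
(* Finite unions of the closed pieces of [U] are closed, and what they leave of [U] decreases to the
   empty set. *)
pose P n := \bigcup_(i < n) C i.
have cP n : closed (P n) by apply: closed_bigcup => //; exact: finite_II.
have [||||n lt_e] := @measure_bigcap_lt _ _ _ mu (fun n => (U `\` P n) `&` V) e%:E.
- by apply: Vlt; apply: measurableD; [exact: borel_open|exact: borel_closed].
- by move=> i; exact: mFU.
- move=> m n mn; apply/subsetPset => x [[Wx nPx] Vx]; split=> //; split=> // -[i im Fi].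
  by apply: nPx; exists i => //=; exact: leq_trans im mn.
- rewrite (_ : \bigcap_n _ = set0) ?measure0 ?lte_fin// -subset0 => x H.
  have [[+ _] _] := H 0%N I; rewrite UC => -[i _ Ci].
  by have [[_ []]] := H i.+1 I; exists i => /=.
exists (P n), U; split=> // x [i _ Ci]; rewrite UC; by exists i.
Qed.

Variable O : (set T)^nat.
Hypotheses (oO : forall i, open (O i)) (Ooo : forall i, mu (O i) < +oo).
Hypothesis (Ocov : \bigcup_i O i = setT).
Hypothesis hausT : hausdorff_space T.
Hypothesis open_sigma_compact : forall U : set T, open U -> exists C : (set T)^nat,
  (forall i, compact (C i)) /\ U = \bigcup_i C i.

Let open_Fsigma (U : set T) : open U -> exists C : (set T)^nat,
  (forall i, closed (C i)) /\ U = \bigcup_i C i.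
Proof.
by move=> /open_sigma_compact[C [cC ->]]; exists C; split=> // i; exact: compact_closed.
Qed.

(** Approximation is available only inside a set of finite measure, so it is done in each [O i] with
    error [e / 2 ^ (i + 1)]; keeping only [U i] inside [O i] makes the errors of the union
    summable. *)
Lemma borel_outer_regular (A : set bT) : measurable A ->
  mu A = ereal_inf [set mu U | U in [set U : set T | open U /\ A `<=` U]].
Proof.
move=> mA; apply/eqP; rewrite eq_le; apply/andP; split.
  apply: le_ereal_inf_tmp => _ [U [oU AU] <-].
  by apply: le_measure; rewrite ?inE//; exact: borel_open.
apply/lee_addgt0Pr => e e0.
have e2 i : (0 < e / (2 ^ i.+1)%:R)%R by rewrite !divr_gt0// ltr0n expn_gt0.
have /choice[F /choice[U FU]] i := closed_open_approx (oO i) (Ooo i) open_Fsigma mA (e2 i).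
pose W := \bigcup_i (U i `&` O i).
have oU i : open (U i) by have [] := FU i.
have oW : open W by apply: bigcup_open => i _; exact: openI.
have AW : A `<=` W.
  move=> x Ax; have [i _ Oi] : (\bigcup_i O i) x by rewrite Ocov.
  by exists i => //; split=> //; have [_ _ _ s _] := FU i; exact: s.
have mUA i : measurable ((U i `&` O i) `\` A : set bT).
  by apply: measurableD => //; apply: borel_open; exact: openI.
apply: (@le_trans _ _ (mu W)); first by apply: ereal_inf_lbound; exists W.
have -> : W = A `|` \bigcup_i ((U i `&` O i) `\` A).
  apply/seteqP; split=> [x [i _ Ui]|x [/AW//|[i _ [Ui _]]]]; last by exists i.
  by have [Ax|nAx] := pselect (A x); [left|right; exists i].
apply: le_trans (measureU2 _ _ _) _ => //; first exact: bigcup_measurable.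
apply: leeD2l; apply: measure_bigcup_geometric => //; first exact: ltW.
move=> i; have [cF _ FA _ lt_e] := FU i; apply/ltW; apply: le_lt_trans lt_e.
apply: le_measure; rewrite ?inE//.
  apply: measurableI; last exact: borel_open.
  by apply: measurableD; [exact: borel_open|exact: borel_closed].
by move=> x [[Ux Ox] nA]; split=> //; split=> // /FA.
Qed.

(** If the supremum [s] were below [mu A], three successive approximations would stay above it: [A]
    cut by a finite union of the [O i], then a closed subset, then its trace on a compact part of
    that finite union. *)
Lemma borel_inner_regular (A : set bT) : measurable A ->
  mu A = ereal_sup [set mu K | K in [set K : set T | compact K /\ K `<=` A]].
Proof.
move=> mA; apply/eqP; rewrite eq_le; apply/andP; split; last first.
  apply: ge_ereal_sup => _ [K [cK KA] <-].
  apply: le_measure; rewrite ?inE//.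
  by apply: borel_closed; apply: compact_closed.
rewrite leNgt; apply/negP; set s := ereal_sup _ => sA.
have sup_ge K : compact K -> K `<=` A -> mu K <= s.
  by move=> cK KA; apply: ereal_sup_ubound; exists K.
have s0 : 0 <= s by rewrite -(measure0 mu); apply: sup_ge => //; exact: compact0.
have sfin : s \is a fin_num by rewrite ge0_fin_numE// (lt_le_trans sA)// leey.
pose V n := \bigcup_(i < n) O i.
have oV n : open (V n) by apply: bigcup_open.
have Voo n : mu (V n) < +oo.
  rewrite /V bigcup_mkord; elim: n => [|n IH]; first by rewrite big_ord0 measure0.
  rewrite big_ord_recr /=; apply: le_lt_trans (measureU2 _ _ _) _.
  - by apply: bigsetU_measurable => i _; exact: borel_open.
  - exact: borel_open.
  - by apply: lte_add_pinfty; [exact: IH|exact: Ooo].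
have mAV n : measurable (A `&` V n : set bT) by apply: measurableI => //; exact: borel_open.
have [|||n sAV] := @measure_bigcup_gt _ _ _ mu (fun n => A `&` V n) s _ _ _.
- exact: mAV.
- move=> i j ij; apply/subsetPset => x [Ax [k ki Ok]]; split=> //; exists k => //=.
  exact: leq_trans ki ij.
- rewrite -setI_bigcupr (_ : \bigcup_n V n = setT) ?setIT//.
  apply/seteqP; split=> // x _; have [i _ Oi] : (\bigcup_i O i) x by rewrite Ocov.
  by exists i.+1 => //; exists i => /=.
have AVfin : mu (A `&` V n) \is a fin_num.
  rewrite ge0_fin_numE//; apply: le_lt_trans (Voo n).
  by apply: le_measure; rewrite ?inE//; exact: borel_open.
(* The error allowed is the whole gap above [s], so the closed subset still has measure above [s]
   inside [V n]. *)
pose e := (fine (mu (A `&` V n)) - fine s)%R.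
have e0 : (0 < e)%R by rewrite subr_gt0 fine_lt.
have [F [U [cF oU FA AU lt_e]]] := closed_open_approx (oV n) (Voo n) open_Fsigma mA e0.
have mUF : measurable ((U `\` F) `&` V n : set bT).
  apply: measurableI; last exact: borel_open.
  by apply: measurableD; [exact: borel_open|exact: borel_closed].
have mFV : measurable (F `&` V n : set bT).
  by apply: measurableI; [exact: borel_closed|exact: borel_open].
have sFV : s < mu (F `&` V n).
  rewrite ltNge; apply/negP => FVs.
  have : mu (A `&` V n) <= mu (F `&` V n) + mu ((U `\` F) `&` V n).
    apply: le_trans (measureU2 _ mFV mUF); apply: le_measure; rewrite ?inE//.
      exact: measurableU.
    move=> x [Ax Vx]; have [Fx|nFx] := pselect (F x); [by left|right].
    by split=> //; split=> //; exact: AU.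
  apply/negP; rewrite -ltNge -(fineK AVfin).
  have -> : fine (mu (A `&` V n)) = (fine s + e)%R by rewrite /e addrC subrK.
  rewrite EFinD fineK// lee_ltD// ge0_fin_numE// (le_lt_trans FVs)//.
  by rewrite -ge0_fin_numE.
have [C [cC VC]] := open_sigma_compact (oV n).
pose P k := \bigcup_(i < k) C i.
have cP k : compact (P k) by rewrite /P bigcup_mkord; exact: bigsetU_compact.
have cFP k : compact (F `&` P k) by rewrite setIC; exact: compact_closedI.
have [|||k sFP] := @measure_bigcup_gt _ _ _ mu (fun k => F `&` P k) s _ _ _.
- by move=> k; apply: borel_closed; apply: compact_closed.
- move=> i j ij; apply/subsetPset => x [Ax [k ki Ok]]; split=> //; exists k => //=.
  exact: leq_trans ki ij.
- rewrite -setI_bigcupr (_ : \bigcup_n P n = V n)// VC.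
  apply/seteqP; split=> x [i _]; first by move=> [j _ Cj]; exists j.
  by move=> Ci; exists i.+1 => //; exists i => /=.
move: sFP; rewrite ltNge => /negP; apply; apply: sup_ge => // x [Fx _]; exact: FA.
Qed.


End borel_regularity.

(** * Scalar products and their Gram matrices *)

Section congruence_to_signs.
Context {R : realType}.

Definition sign_mx m (s : 'I_m -> R) : 'M[R]_m := diag_mx (\row_i s i).

(* A symmetric matrix close enough to a diagonal matrix of signs is congruent to
   it: eliminate with the first pivot, which stays away from zero, and recurse on
   the Schur complement, whose distance to the signs has at most doubled. *)
Lemma near_sign_mx_congruent m (s : 'I_m -> R) (S : 'M[R]_m) :
  (forall i, `|s i| = 1) -> S^T = S ->
  (forall i j, `|S i j - sign_mx s i j| <= (2 ^+ m.+2)^-1) ->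
  exists P : 'M[R]_m, P *m S *m P^T = sign_mx s.
Proof.
elim: m s S => [|m IH].
  by move=> s S _ _ _; exists 0; apply/matrixP => -[].
set e := (2 ^+ m.+3)^-1.
change (forall (s : 'I_(1 + m) -> R) (S : 'M[R]_(1 + m)),
  (forall i, `|s i| = 1) -> S^T = S -> (forall i j, `|S i j - sign_mx s i j| <= e) ->
  exists P : 'M[R]_(1 + m), P *m S *m P^T = sign_mx s) => s S s1 ST Ss.
have e_gt0 : 0 < e by rewrite invr_gt0 exprn_gt0.
(* The offset 2 in the exponent of the tolerance ensures this bound at every positive size, the last
   one included. *)
have e4 : e <= 1 / 8.
  rewrite /e div1r lef_pV2 ?posrE ?exprn_gt0//.
  rewrite (_ : 8 = 2 ^+ 3); last by rewrite -natrX.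
  by rewrite ler_eXn2l ?ltr1n.
have e2 : 2 * e = (2 ^+ m.+2)^-1 by rewrite /e exprS invfM mulrA divff ?mul1r.
pose a := ulsubmx S 0 0; pose b := dlsubmx S; pose D := drsubmx S.
pose s0 := s (lshift m (ord0 : 'I_1)); pose s' i := s (rshift 1 i).
have aE : ulsubmx S = a%:M.
  by apply/matrixP => i j; rewrite !ord1 [RHS]mxE eqxx mulr1n.
have bT : ursubmx S = b^T by rewrite /b trmx_dlsub ST.
have DT : D^T = D by rewrite /D trmx_drsub ST.
have as0 : `|a - s0| <= e.
  have := Ss (lshift m ord0) (lshift m ord0).
  rewrite /sign_mx /a /s0 /ulsubmx !mxE eqxx mulr1n; apply.
have bs i : `|b i 0| <= e.
  have := Ss (rshift 1 i) (lshift m ord0).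
  rewrite /sign_mx /b /dlsubmx !mxE eq_rlshift mulr0n subr0; apply.
have Ds i j : `|D i j - sign_mx s' i j| <= e.
  have := Ss (rshift 1 i) (rshift 1 j).
  rewrite /sign_mx /D /s' /drsubmx !mxE eq_rshift; apply.
have a_big : 7 / 8 <= `|a|.
  have : `|s0| <= `|a| + `|a - s0|.
    by rewrite -(distrC s0) -[X in `|X|](subrK a) addrC ler_normD.
  by rewrite s1; lra.
have a0 : a != 0 by rewrite -normr_gt0; lra.
have a_s0 : a = s0 * `|a|.
  have /eqP : `|s0| = 1 := s1 _.
  rewrite eqr_norml ler01 andbT => /orP[/eqP s0E|/eqP s0E]; move: as0; rewrite s0E.
    rewrite ler_norml => /andP[h _]; rewrite mul1r ger0_norm//; lra.
  rewrite ler_norml => /andP[_ h]; rewrite mulN1r ler0_norm ?opprK//; lra.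
have bE : dlsubmx S = b by [].
have DE : drsubmx S = D by [].
clearbody e a b D.
pose D' := D - a^-1 *: (b *m b^T).
have [P' P'E] : exists P : 'M[R]_m, P *m D' *m P^T = sign_mx s'.
  apply: IH => [i||i j]; first exact: s1.
    by rewrite /D' linearB linearZ /= trmx_mul trmxK DT.
  rewrite -e2 /D' !mxE big_ord1 !mxE.
  set t := a^-1 * _; rewrite addrAC; apply: (le_trans (ler_normB _ _)).
  (* The correction is at most [e * e / |a|], and [e <= 1 / 8] while [|a| >= 7 / 8]; it accounts for
     the doubling of the tolerance. *)
  have tE : `|t| <= e.
    rewrite /t !normrM normfV ler_pdivrMl ?normr_gt0//.
    apply: (@le_trans _ _ (e * e)); first by apply: ler_pM.
    by apply: ler_pM => //; [exact: ltW|exact: ltW|lra].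
  have := Ds i j; rewrite /sign_mx !mxE => ?; lra.
(* The pivot has the sign [s0], so rescaling its row and column by [c] turns it into [s0]
   exactly. *)
pose c := (Num.sqrt `|a|)^-1.
have cE : c * a * c = s0.
  rewrite mulrAC /c -invfM -expr2 sqr_sqrtr// {2}a_s0 mulrCA mulVf ?mulr1//.
  by rewrite normr_eq0.
pose L : 'M[R]_(1 + m) := block_mx 1%:M 0 (- a^-1 *: b) 1%:M.
pose C : 'M[R]_(1 + m) := block_mx c%:M 0 0 P'.
have LSL : L *m S *m L^T = block_mx a%:M 0 0 D'.
  rewrite /L tr_block_mx -[S in _ *m S *m _]submxK !mulmx_block aE bT bE DE.
  rewrite !trmx1 !trmx0 !mul1mx !mul0mx !mulmx1 !mulmx0 !addr0 !linearZ /=.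
  rewrite -!scalemxAl !mul_mx_scalar !mul_scalar_mx !scalerA mulNr mulVf//.
  by rewrite !scaleN1r !addNr mul0mx scaler0 add0r scaleNr addrC.
exists (C *m L).
rewrite trmx_mul !mulmxA -(mulmxA C L) -(mulmxA C _ L^T) LSL.
rewrite /C tr_block_mx !mulmx_block !trmx0 !(mul0mx, mulmx0, addr0, add0r) P'E.
rewrite tr_scalar_mx -!scalar_mxM cE.
apply/matrixP => i j.
have [i' ->|i' ->] := split_ordP i; have [j' ->|j' ->] := split_ordP j;
  rewrite ?(block_mxEul, block_mxEur, block_mxEdl, block_mxEdr) !mxE.
- by rewrite !ord1 !eqxx !mulr1n.
- by rewrite eq_lrshift mulr0n.
- by rewrite eq_rlshift mulr0n.
- by rewrite eq_rshift.
Qed.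

End congruence_to_signs.

Lemma scalar0 (R : realType) (V : vectType R) (f : V -> R) : scalar f -> f 0 = 0.
Proof.
move=> fl; have := fl 1 0 0; rewrite scaler0 addr0 mul1r => /esym/eqP.
by rewrite -subr_eq0 addrK => /eqP.
Qed.

Lemma scalar_sum (R : realType) (V : vectType R) (f : V -> R) (I : finType)
    (c : I -> R) (x : I -> V) :
  scalar f -> f (\sum_i c i *: x i) = \sum_i c i * f (x i).
Proof.
by move=> fl; elim/big_rec2: _ => [|i y1 y2 _ <-]; [exact: scalar0|exact: fl].
Qed.

Section forms_and_matrices.
Context {R : realType} {V : vectType R}.
Local Notation n := (\dim {:V}).
Local Notation N := #|le_pairs n|.

Lemma bilinear_sum (g : forms V) (c d : 'I_n -> R) (x y : 'I_n -> V) :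
  bilinear_form g ->
  g (\sum_i c i *: x i) (\sum_j d j *: y j) = \sum_i \sum_j c i * g (x i) (y j) * d j.
Proof.
move=> [gl gr]; rewrite (scalar_sum _ _ (gr _)); apply: eq_bigr => i _.
rewrite (scalar_sum _ _ (gl _)) big_distrr; apply: eq_bigr => j _ /=.
by rewrite mulrCA mulrC.
Qed.

(** Pairing a combination of the vectors with [e i] returns its [i]-th coefficient up to sign, so
    the independence of the tuple and then the nondegeneracy of [g] follow from the Gram matrix. *)
Lemma scalar_product_orthonormal p p' (g : forms V) (e : n.-tuple V) (s : 'I_n -> R) :
  bilinear_form g -> (forall x y, g x y = g y x) ->
  (forall i j, g (tnth e i) (tnth e j) = s i *+ (i == j)) ->
  (forall i, s i = 1 \/ s i = - 1) ->
  #|[pred i | s i == 1]| = p -> #|[pred i | s i == - 1]| = p' ->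
  scalar_products p p' g.
Proof.
move=> gb gC ge s1 sp sp'.
have s0 i : s i != 0 by case: (s1 i) => ->; rewrite ?oppr_eq0 oner_eq0.
have gE c i : g (\sum_j c j *: tnth e j) (tnth e i) = c i * s i.
  rewrite (scalar_sum _ _ (gb.2 _)) (bigD1 i)//= ge eqxx mulr1n big1 ?addr0// => j ji.
  by rewrite ge (negbTE ji) mulr0.
have be : basis_of {:V} e.
  rewrite basisEfree subvf size_tuple leqnn !andbT; apply/freeP => c c0 i.
  have := gE c i; under eq_bigr do rewrite (tnth_nth 0).
  rewrite c0 (scalar0 (gb.2 _)) => /esym/eqP.
  by rewrite mulf_eq0 (negbTE (s0 i)) orbF => /eqP.
split; first split=> // x gx0.
  have xE : x = \sum_j coord e j x *: tnth e j.
    rewrite {1}(coord_basis be (memvf x)); apply: eq_bigr => i _.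
    by rewrite (tnth_nth 0).
  rewrite xE big1// => i _; have := gE (fun j => coord e j x) i.
  rewrite -xE gx0 => /esym/eqP; rewrite mulf_eq0 (negbTE (s0 i)) orbF => /eqP ->.
  by rewrite scale0r.
exists e; split=> //.
- by move=> i j ij; rewrite ge (negbTE ij).
- by move=> i; rewrite ge eqxx mulr1n.
- by rewrite -sp; apply: eq_card => i; rewrite !inE ge eqxx mulr1n.
- by rewrite -sp'; apply: eq_card => i; rewrite !inE ge eqxx mulr1n.
Qed.

Definition form_of_mx (v : n.-tuple V) (M : 'M[R]_n) : forms V :=
  fun x y => \sum_i \sum_j coord v i x * M i j * coord v j y.

Lemma form_of_mx_bilinear v M : bilinear_form (form_of_mx v M).
Proof.
split=> [x a y z|x a y z]; rewrite /form_of_mx big_distrr -big_split /=;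
  apply: eq_bigr => i _; rewrite big_distrr -big_split /=; apply: eq_bigr => j _.
  by rewrite linearP /= mulrDr [a * _]mulrCA.
by rewrite linearP /= !mulrDl -!mulrA.
Qed.

Lemma form_of_mx_sym v M : M^T = M -> forall x y, form_of_mx v M x y = form_of_mx v M y x.
Proof.
move=> MT x y; rewrite /form_of_mx exchange_big /=; apply: eq_bigr => i _.
apply: eq_bigr => j _; rewrite -{1}MT mxE mulrAC [RHS]mulrAC; congr (_ * _).
exact: mulrC.
Qed.

Variables (v : n.-tuple V) (bv : basis_of {:V} v).

Lemma coord_tnth i j : coord v i (tnth v j) = (i == j)%:R.
Proof. by rewrite (tnth_nth 0) coord_free ?(basis_free bv)// eq_sym. Qed.

Lemma tuple_basisE x : x = \sum_i coord v i x *: tnth v i.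
Proof.
rewrite {1}(coord_basis bv (memvf x)); apply: eq_bigr => i _.
by rewrite (tnth_nth 0).
Qed.

Lemma gram_form_of_mx M : gram v (form_of_mx v M) = M.
Proof.
apply/matrixP => i j; rewrite mxE /form_of_mx (bigD1 i)//= (bigD1 j)//=.
rewrite !coord_tnth !eqxx mul1r mulr1 big1 => [|k kj]; last first.
  by rewrite !coord_tnth (negbTE kj) mulr0.
rewrite addr0 big1 ?addr0// => k ki; rewrite big1// => l _.
by rewrite !coord_tnth (negbTE ki) !mul0r.
Qed.

Lemma form_of_mx_gram (g : forms V) : bilinear_form g -> form_of_mx v (gram v g) = g.
Proof.
move=> gb; apply/funext => x; apply/funext => y.
rewrite [in RHS](tuple_basisE x) [in RHS](tuple_basisE y) bilinear_sum//.
by apply: eq_bigr => i _; apply: eq_bigr => j _; rewrite mxE.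
Qed.

Lemma gram_change (g : forms V) (w : n.-tuple V) (P : 'M[R]_n) : bilinear_form g ->
  (forall i, tnth w i = \sum_j P i j *: tnth v j) ->
  gram w g = P *m gram v g *m P^T.
Proof.
move=> gb wE; apply/matrixP => i j; rewrite mxE !wE bilinear_sum// mxE exchange_big /=.
apply: eq_bigr => k _; rewrite mxE [in RHS]mxE big_distrl; apply: eq_bigr => l _ /=.
by rewrite mxE.
Qed.

End forms_and_matrices.

(** * Symmetric matrices and their upper triangular coordinates *)

Section pair_index.
Variable n : nat.
Local Notation N := #|le_pairs n|.

Definition sorted_pair (i j : 'I_n) : 'I_n * 'I_n := if (i <= j)%N then (i, j) else (j, i).

Lemma sorted_pairP i j : sorted_pair i j \in le_pairs n.
Proof.
rewrite /sorted_pair inE; case: ifP => //= /negbT; rewrite -ltnNge; exact: ltnW.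
Qed.

Definition pair_index (i j : 'I_n) : 'I_N := enum_rank_in (sorted_pairP i j) (sorted_pair i j).

Lemma pair_indexE i j : enum_val (pair_index i j) = sorted_pair i j.
Proof. by rewrite enum_rankK_in// sorted_pairP. Qed.

Lemma sorted_pair_enum_val (I : 'I_N) : sorted_pair (enum_val I).1 (enum_val I).2 = enum_val I.
Proof.
rewrite /sorted_pair; have := enum_valP I; rewrite inE => ->.
by rewrite -surjective_pairing.
Qed.

Lemma pair_index_enum_val (I : 'I_N) : pair_index (enum_val I).1 (enum_val I).2 = I.
Proof. by apply: enum_val_inj; rewrite pair_indexE sorted_pair_enum_val. Qed.

Lemma pair_indexC i j : pair_index i j = pair_index j i.
Proof.
apply: enum_val_inj; rewrite !pair_indexE /sorted_pair.
by case: (ltngtP i j) => // /val_inj ->.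
Qed.

Definition sym_mx {R : realType} (t : N.-tuple R) : 'M[R]_n :=
  \matrix_(i, j) tnth t (pair_index i j).

Lemma sym_mxT {R : realType} (t : N.-tuple R) : (sym_mx t)^T = sym_mx t.
Proof. by apply/matrixP => i j; rewrite !mxE pair_indexC. Qed.

Definition mx_coords {R : realType} (M : 'M[R]_n) : N.-tuple R :=
  [tuple M (enum_val I).1 (enum_val I).2 | I < N].

Lemma sym_mxK {R : realType} (t : N.-tuple R) : mx_coords (sym_mx t) = t.
Proof.
by apply: eq_from_tnth => I; rewrite tnth_mktuple mxE pair_index_enum_val.
Qed.

Lemma mx_coordsK {R : realType} (M : 'M[R]_n) : M^T = M -> sym_mx (mx_coords M) = M.
Proof.
move=> MT; apply/matrixP => i j; rewrite mxE tnth_mktuple pair_indexE /sorted_pair.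
by case: ifP => //= _; rewrite -{1}MT mxE.
Qed.

End pair_index.

Section coordinate_map.
Variables (R : realType) (V : vectType R) (p p' : nat) (h : (p + p' = \dim {:V})%N).
Local Notation n := (\dim {:V}).
Local Notation N := #|le_pairs n|.
Implicit Type g : Gamma h.

Lemma form_of_scalar_products g : scalar_products p p' (form_of g).
Proof. by case: g => g /= /set_mem. Qed.

Lemma form_of_bilinear g : bilinear_form (form_of g).
Proof. by have [[]] := form_of_scalar_products g. Qed.

Lemma form_of_sym g x y : form_of g x y = form_of g y x.
Proof. by have [[]] := form_of_scalar_products g. Qed.

Lemma form_of_inj : injective (@form_of R V p p' h).
Proof. by move=> [g gP] [g' gP'] /= gg'; exact: eq_sig_hprop. Qed.

Definition Gamma_of (g : forms V) (gP : scalar_products p p' g) : Gamma h :=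
  exist (fun f => f \in @scalar_products R V p p') g (mem_set gP).

Variables (v : n.-tuple V) (bv : basis_of {:V} v).

Lemma gram_formT g : (gram v (form_of g))^T = gram v (form_of g).
Proof. by apply/matrixP => i j; rewrite !mxE form_of_sym. Qed.

Lemma coordsE g : coords v g = mx_coords (gram v (form_of g)).
Proof. by []. Qed.

Lemma sym_mx_coords g : sym_mx (coords v g) = gram v (form_of g).
Proof. by rewrite coordsE mx_coordsK// gram_formT. Qed.

Lemma form_of_coords g : form_of_mx v (sym_mx (coords v g)) = form_of g.
Proof. by rewrite sym_mx_coords form_of_mx_gram//; exact: form_of_bilinear. Qed.

Lemma coords_inj : injective (coords (h := h) v).
Proof.
by move=> g g' gg'; apply: form_of_inj; rewrite -!form_of_coords gg'.
Qed.

Lemma coords_Gamma_of t (tP : scalar_products p p' (form_of_mx v (sym_mx t))) :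
  coords v (Gamma_of tP) = t.
Proof. by rewrite coordsE gram_form_of_mx// sym_mxK. Qed.

Lemma range_coordsP t :
  range (coords (h := h) v) t <-> scalar_products p p' (form_of_mx v (sym_mx t)).
Proof.
split=> [[g _ <-]|tP]; last by exists (Gamma_of tP) => //; exact: coords_Gamma_of.
by rewrite form_of_coords; exact: form_of_scalar_products.
Qed.

End coordinate_map.

(** The congruence matrix [P] produces a tuple [w] with exactly the signs [s]; that [w] is a basis
    is then read off its Gram matrix. This stability of the signature makes the chart image open. *)
Lemma near_orthonormal (R : realType) (V : vectType R) p p' (g : forms V)
    (e : (\dim {:V}).-tuple V) (s : 'I_(\dim {:V}) -> R) :
  bilinear_form g -> (forall x y, g x y = g y x) ->
  (forall i, s i = 1 \/ s i = - 1) ->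
  #|[pred i | s i == 1]| = p -> #|[pred i | s i == - 1]| = p' ->
  (forall i j, `|g (tnth e i) (tnth e j) - s i *+ (i == j)| <= (2 ^+ (\dim {:V}).+2)^-1) ->
  scalar_products p p' g.
Proof.
move=> gb gC s1 sp sp' ge.
have [|||P PE] := @near_sign_mx_congruent R _ s (gram e g).
- by move=> i; case: (s1 i) => ->; rewrite ?normrN normr1.
- by apply/matrixP => i j; rewrite !mxE gC.
- by move=> i j; rewrite /sign_mx !mxE; exact: ge.
pose w := [tuple \sum_j P i j *: tnth e j | i < \dim {:V}].
apply: (scalar_product_orthonormal (e := w) (s := s)) => // i j.
have /matrixP/(_ i j) : gram w g = sign_mx s.
  rewrite -PE; have := @gram_change R V e g w P gb; apply.
  by move=> k; rewrite tnth_mktuple.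
by rewrite /sign_mx !mxE.
Qed.

(** * The coordinate chart *)

Lemma continuous_ptws (X : topologicalType) (I : Type) (T : topologicalType)
    (F : X -> {ptws I -> T}) :
  (forall i, continuous (fun x => F x i)) -> continuous F.
Proof.
move=> cF x; apply/cvg_sup => i U [_ [[W oW <-] Wx] WU].
rewrite nbhs_simpl; apply: (filterS WU).
by have := cF i x; apply; exact: open_nbhs_nbhs.
Qed.

Lemma continuous_ptws_eval (I : eqType) (T : topologicalType) (i : I) :
  continuous (fun f : {ptws I -> T} => f i).
Proof. exact: (@proj_continuous I (fun=> T) i). Qed.

Lemma continuous_mx (X T : topologicalType) m n (F : X -> 'M[T]_(m, n)) :
  (forall i j, continuous (fun x => F x i j)) -> continuous F.
Proof.
move=> cF x U [P PM PU]; rewrite nbhs_simpl /=.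
have H : \forall y \near x, forall i j, P i j (F y i j).
  by apply: filter_forall => i; apply: filter_forall => j; apply: cF; exact: PM.
by apply: filterS H => y Hy; apply: PU.
Qed.

Lemma continuous_sum (R : realType) (X : topologicalType) (I : Type) (r : seq I)
    (F : I -> X -> R) :
  (forall i, continuous (F i)) -> continuous (fun x => \sum_(i <- r) F i x).
Proof. by move=> cF; apply: continuous_big => //; exact: add_continuous. Qed.

Lemma continuous_prod (R : realType) (X : topologicalType) (I : Type) (r : seq I)
    (F : I -> X -> R) :
  (forall i, continuous (F i)) -> continuous (fun x => \prod_(i <- r) F i x).
Proof. by move=> cF; apply: continuous_big => //; exact: mul_continuous. Qed.

Lemma continuous_mul (R : realType) (X : topologicalType) (f g : X -> R) :
  continuous f -> continuous g -> continuous (fun x => f x * g x).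
Proof. by move=> cf cg x; apply: cvgM; [exact: cf|exact: cg]. Qed.

Lemma continuous_det (R : realType) (X : topologicalType) m (F : X -> 'M[R]_m) :
  (forall i j, continuous (fun x => F x i j)) -> continuous (fun x => \det (F x)).
Proof.
move=> cF; apply: continuous_sum => s; apply: continuous_mul.
  by move=> x; exact: cvg_cst.
by apply: continuous_prod => i; exact: cF.
Qed.

(** Cramer's rule: each entry is a cofactor divided by a determinant that never vanishes. *)
Lemma continuous_invmx (R : realType) (X : topologicalType) m (F : X -> 'M[R]_m) :
  (forall x, F x \in unitmx) ->
  (forall i j, continuous (fun x => F x i j)) ->
  forall i j, continuous (fun x => invmx (F x) i j).
Proof.
move=> uF cF i j.
rewrite (_ : (fun x => _) = fun x => (\det (F x))^-1 * cofactor (F x) j i); last first.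
  by apply/funext => x; rewrite /invmx uF !mxE.
apply: continuous_mul.
  move=> x; apply: cvgV; last exact: continuous_det.
  by have := uF x; rewrite unitmxE unitfE.
rewrite /cofactor; apply: continuous_mul; first by move=> x; exact: cvg_cst.
apply: continuous_det => k l.
by under [X in continuous X]funext do rewrite !mxE; exact: cF.
Qed.

Section rows_and_tuples.
Context {R : Type} {m : nat}.

(** Lebesgue measure lives on tuples and the normed topology on row vectors; topological arguments
    go through this translation. *)
Definition row_of_tuple (t : m.-tuple R) : 'rV[R]_m := \row_i tnth t i.
Definition tuple_of_row (r : 'rV[R]_m) : m.-tuple R := [tuple r ord0 i | i < m].

Lemma row_of_tupleK : cancel row_of_tuple tuple_of_row.
Proof. by move=> t; apply: eq_from_tnth => i; rewrite tnth_mktuple mxE. Qed.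

Lemma tuple_of_rowK : cancel tuple_of_row row_of_tuple.
Proof. by move=> r; apply/rowP => i; rewrite mxE tnth_mktuple. Qed.

End rows_and_tuples.

Section chart.
Variables (R : realType) (V : vectType R) (p p' : nat) (h : (p + p' = \dim {:V})%N).
Local Notation n := (\dim {:V}).
Local Notation N := #|le_pairs n|.

Lemma form_of_continuous : continuous (@form_of R V p p' h : Gamma h -> forms V).
Proof. by apply/continuousP => A oA; exists A. Qed.

Lemma form_of_eval_continuous x y : continuous (fun g : Gamma h => form_of g x y).
Proof.
move=> g; apply: (@continuous_comp _ _ _ (fun g : Gamma h => form_of g x : {ptws V -> R})
  (fun f : {ptws V -> R} => f y)); last exact: continuous_ptws_eval.
apply: (@continuous_comp _ _ _ (fun g : Gamma h => form_of g : forms V)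
  (fun f : {ptws V -> {ptws V -> R}} => f x)); last exact: continuous_ptws_eval.
exact: form_of_continuous.
Qed.

Lemma continuous_to_Gamma (X : topologicalType) (F : X -> Gamma h) :
  (forall x y, continuous (fun a => form_of (F a) x y)) -> continuous F.
Proof.
move=> cF a U [_ [[W oW <-] Wa] WU].
have cf : continuous (fun a => form_of (F a) : forms V).
  by apply: continuous_ptws => x; apply: continuous_ptws => y; exact: cF.
have : nbhs a ((fun a => form_of (F a) : forms V) @^-1` W).
  by have := cf a; apply; exact: open_nbhs_nbhs.
by rewrite nbhs_simpl /=; apply: filterS => b Wb; exact: WU.
Qed.

Variables (v : n.-tuple V) (bv : basis_of {:V} v).

Definition chart (g : Gamma h) : 'rV[R]_N := row_of_tuple (coords v g).

Lemma chart_inj : injective chart.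
Proof. by move=> g g' /(can_inj row_of_tupleK)/coords_inj; apply. Qed.

Lemma chart_continuous : continuous chart.
Proof.
apply: continuous_mx => i j.
rewrite (_ : (fun x => _) = (fun g => form_of g (tnth v (enum_val j).1) (tnth v (enum_val j).2))).
  exact: form_of_eval_continuous.
by apply/funext => g; rewrite mxE tnth_mktuple mxE.
Qed.

Lemma Gamma_hausdorff : hausdorff_space (Gamma h).
Proof.
move=> x y cxy; apply: chart_inj.
apply: (@norm_hausdorff _ 'rV[R]_N) => A B nA nB.
have [z [Az Bz]] := cxy _ _ (chart_continuous nA) (chart_continuous nB).
by exists (chart z).
Qed.

(** Inverse of the chart, but defined on all of [R^N], degenerate forms included, so that its
    continuity can be stated without reference to the chart image. *)
Definition form_of_row (r : 'rV[R]_N) : forms V := form_of_mx v (sym_mx (tuple_of_row r)).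

Lemma form_of_row_eval_continuous x y : continuous (fun r : 'rV[R]_N => form_of_row r x y).
Proof.
apply: continuous_sum => i; apply: continuous_sum => j.
apply: continuous_mul; last exact: cst_continuous.
apply: continuous_mul; first exact: cst_continuous.
rewrite (_ : (fun r => _) = (fun r : 'rV[R]_N => r ord0 (pair_index i j))).
  exact: coord_continuous.
by apply/funext => r; rewrite mxE tnth_mktuple.
Qed.

Lemma form_of_row_continuous : continuous form_of_row.
Proof.
by apply: continuous_ptws => x; apply: continuous_ptws => y;
  exact: form_of_row_eval_continuous.
Qed.

Lemma form_of_row_chart g : form_of_row (chart g) = form_of g.
Proof. by rewrite /form_of_row row_of_tupleK form_of_coords. Qed.

Lemma range_chartP r : range chart r <-> scalar_products p p' (form_of_row r).
Proof.
rewrite /form_of_row; split => [[g _ <-]|/(range_coordsP h bv)[g _ gr]].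
  by rewrite row_of_tupleK; apply/(range_coordsP h bv); exists g.
by exists g => //; rewrite /chart gr tuple_of_rowK.
Qed.

(** The finitely many values on pairs from a basis orthonormal at [r0] depend continuously on the
    row, so near [r0] they stay within the tolerance that preserves the signature. *)
Lemma range_chart_open : open (range chart).
Proof.
suff K (r0 : 'rV[R]_N) : range chart r0 -> nbhs r0 (range chart).
  by rewrite openE => r0 /K.
move=> /range_chartP[[g0b g0C _] [e [be eo e1 ep ep']]].
pose s i := form_of_row r0 (tnth e i) (tnth e i).
pose eps : R := (2 ^+ n.+2)^-1.
have eps0 : 0 < eps by rewrite invr_gt0 exprn_gt0.
have H0 i j : \forall r \near r0,
    `|form_of_row r0 (tnth e i) (tnth e j) - form_of_row r (tnth e i) (tnth e j)| < eps.
  by have /cvgrPdist_lt := @form_of_row_eval_continuous (tnth e i) (tnth e j) r0; exact.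
have H := filter_forall _ (fun i => filter_forall _ (H0 i)).
apply: filterS (H (nbhs_filter r0) (nbhs_filter r0)) => r Hr; apply/range_chartP.
apply: (near_orthonormal (e := e) (s := s)) => //.
- exact: form_of_mx_bilinear.
- by apply: form_of_mx_sym; exact: sym_mxT.
- move=> i j; rewrite distrC; apply/ltW; apply: le_lt_trans (Hr i j).
  have [->|ij] := eqVneq i j; first by rewrite mulr1n.
  by rewrite (eo _ _ ij).
Qed.

Lemma chart_open U : open U -> open (chart @` U).
Proof.
move=> [W oW WU]; rewrite (_ : _ @` _ = range chart `&` form_of_row @^-1` W).
  apply: openI; first exact: range_chart_open.
  by apply: open_comp => // r _; exact: form_of_row_continuous.
apply/seteqP; split=> [r [g Ug <-]|r [[g _ <-] /=]].
  by split; [exists g|rewrite /= form_of_row_chart; move: Ug; rewrite -WU].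
by rewrite form_of_row_chart => Wg; exists g => //; rewrite -WU.
Qed.

(** A row in the kernel gives the coordinates of a vector orthogonal to all of [V]. *)
Lemma gram_unitmx (g : Gamma h) : gram v (form_of g) \in unitmx.
Proof.
rewrite -row_free_unit -kermx_eq0; apply/eqP/row_matrixP => i; rewrite row0.
set c := row i _; have c0 : c *m gram v (form_of g) = 0.
  by apply/sub_kermxP; exact: row_sub.
clearbody c.
have [gb _] := form_of_scalar_products g.
have [[gbl gbr] gC gnd] := gb.
suff x0 : \sum_j c 0 j *: tnth v j = 0.
  apply/rowP => j; rewrite mxE.
  have /freeP fv := basis_free bv; apply: (fv (fun k => c 0 k)).
  by rewrite -[RHS]x0; apply: eq_bigr => k _; rewrite (tnth_nth 0).
apply: gnd => y; rewrite (scalar_sum _ _ (gbr y)).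
rewrite {1}(tuple_basisE bv y).
under eq_bigr do rewrite (scalar_sum _ _ (gbl _)) big_distrr /=.
rewrite exchange_big /= big1// => k _.
have /rowP/(_ k) := c0; rewrite !mxE => ck.
transitivity (coord v k y * \sum_j c 0 j * gram v (form_of g) j k).
  by rewrite big_distrr /=; apply: eq_bigr => j _; rewrite mxE mulrCA.
by rewrite ck mulr0.
Qed.

End chart.

(** * The density of the natural metric *)

Section metric_on_matrices.
Context {R : realType} {n : nat}.
Local Notation N := #|le_pairs n|.
Implicit Types G A B P : 'M[R]_n.

(** The natural metric written as a trace, a form in which its behaviour under congruence is matrix
    algebra. *)
Definition mx_metric G A B : R := \tr (invmx G *m B *m (invmx G)^T *m A^T).

Lemma mx_metricE G A B : mx_metric G A B =
  \sum_i \sum_j \sum_k \sum_l invmx G i k * invmx G j l * (A i j * B k l).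
Proof.
apply: eq_bigr => i _; rewrite mxE; apply: eq_bigr => j _.
rewrite mxE [in RHS]exchange_big /= big_distrl /=; apply: eq_bigr => l _.
rewrite mxE !big_distrl /=; apply: eq_bigr => k _.
rewrite !mxE; ring.
Qed.

Lemma mx_metric_suml G (I : finType) (c : I -> R) (A : I -> 'M[R]_n) B :
  mx_metric G (\sum_i c i *: A i) B = \sum_i c i * mx_metric G (A i) B.
Proof.
rewrite /mx_metric linear_sum /= mulmx_sumr linear_sum /=; apply: eq_bigr => i _.
by rewrite linearZ /= -scalemxAr mxtraceZ.
Qed.

Lemma mx_metric_sumr G (I : finType) (c : I -> R) A (B : I -> 'M[R]_n) :
  mx_metric G A (\sum_i c i *: B i) = \sum_i c i * mx_metric G A (B i).
Proof.
rewrite /mx_metric mulmx_sumr !mulmx_suml linear_sum /=; apply: eq_bigr => i _.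
by rewrite -scalemxAr -!scalemxAl mxtraceZ.
Qed.

(** The inverse of the congruent matrix carries the inverse factors of [P], which cancel against
    those around [A] and [B], the last pair by cyclicity of the trace. This is the independence of
    [Q] from the basis. *)
Lemma mx_metric_congr P G A B : P \in unitmx -> G \in unitmx ->
  mx_metric (P *m G *m P^T) (P *m A *m P^T) (P *m B *m P^T) = mx_metric G A B.
Proof.
move=> uP uG; have uPT : P^T \in unitmx by rewrite unitmx_tr.
have XY : P *m G *m P^T *m (invmx P^T *m invmx G *m invmx P) = 1%:M.
  by rewrite !mulmxA mulmxK// mulmxK// mulmxV.
have -> : mx_metric (P *m G *m P^T) (P *m A *m P^T) (P *m B *m P^T) =
    \tr (invmx P^T *m invmx G *m invmx P *m (P *m B *m P^T) *m
      (invmx P^T *m invmx G *m invmx P)^T *m (P *m A *m P^T)^T).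
  rewrite /mx_metric (_ : invmx (P *m G *m P^T) = invmx P^T *m invmx G *m invmx P)//.
  rewrite -[LHS]mulmx1 -XY mulKmx//.
  by rewrite !unitmx_mul uP uG.
rewrite !trmx_mul !trmxK (trmx_inv P^T) trmxK (trmx_inv P) !mulmxA.
rewrite mulmxKV// mulmxK// mulmxKV// mxtrace_mulC !mulmxA mulmxV// mul1mx.
by [].
Qed.

Definition coord_mx (I : 'I_N) : 'M[R]_n := sym_mx [tuple (I == J)%:R | J < N].

Lemma sym_mx_sum (t : N.-tuple R) : sym_mx t = \sum_I tnth t I *: coord_mx I.
Proof.
apply/matrixP => i j; rewrite summxE mxE (bigD1 (pair_index i j))//= !mxE.
rewrite tnth_mktuple eqxx mulr1 big1 ?addr0// => I Iij.
by rewrite !mxE tnth_mktuple (negbTE Iij) mulr0.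
Qed.

Definition metric_matrix G : 'M[R]_N := \matrix_(I, J) mx_metric G (coord_mx I) (coord_mx J).

(** The matrix, in upper triangular coordinates, of the map sending a symmetric [M] to
    [P *m M *m P^T]. *)
Definition congr_mx P : 'M[R]_N :=
  \matrix_(I, J) tnth (mx_coords (P *m coord_mx J *m P^T)) I.

Lemma congr_mxE P (t : N.-tuple R) :
  linear_tuple (congr_mx P) t = mx_coords (P *m sym_mx t *m P^T).
Proof.
apply: eq_from_tnth => I; rewrite !tnth_mktuple sym_mx_sum mulmx_sumr mulmx_suml summxE.
apply: eq_bigr => J _; rewrite mxE tnth_mktuple mulrC.
by rewrite -scalemxAr -scalemxAl [RHS]mxE.
Qed.

Lemma sym_congr P t : (P *m sym_mx t *m P^T)^T = P *m sym_mx t *m P^T :> 'M[R]_n.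
Proof. by rewrite !trmx_mul trmxK sym_mxT mulmxA. Qed.

(** Congruence by [invmx P] undoes congruence by [P]; the determinant, a power of [det P], is not
    computed. *)
Lemma congr_mx_unit P : P \in unitmx -> congr_mx P \in unitmx.
Proof.
move=> uP; suff : congr_mx (invmx P) *m congr_mx P = 1%:M by move=> /mulmx1_unit[].
have H t : linear_tuple (congr_mx (invmx P) *m congr_mx P) t = t.
  rewrite linear_tupleM !congr_mxE mx_coordsK ?sym_congr// trmx_inv !mulmxA mulVmx//.
  by rewrite mul1mx mulmxK ?unitmx_tr// sym_mxK.
apply/matrixP => I J; have := congr1 (fun t => tnth t I) (H [tuple (J == K)%:R | K < N]).
rewrite !tnth_mktuple (bigD1 J)//= tnth_mktuple eqxx mulr1 big1 => [|K KJ]; last first.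
  by rewrite tnth_mktuple eq_sym (negbTE KJ) mulr0.
by rewrite addr0 => ->; rewrite mxE eq_sym.
Qed.

Lemma metric_matrix_congr P G : P \in unitmx -> G \in unitmx ->
  metric_matrix G = (congr_mx P)^T *m metric_matrix (P *m G *m P^T) *m congr_mx P.
Proof.
move=> uP uG; apply/matrixP => I J; rewrite mxE -(mx_metric_congr _ _ uP uG).
have E K : P *m coord_mx K *m P^T = \sum_L congr_mx P L K *: coord_mx L.
  rewrite -[LHS](mx_coordsK (sym_congr P _)) sym_mx_sum; apply: eq_bigr => L _.
  by rewrite mxE.
rewrite !E mx_metric_sumr mxE; apply: eq_bigr => K _; rewrite mx_metric_suml mulrC.
congr (_ * _); rewrite [RHS]mxE; apply: eq_bigr => L _.
by rewrite [(congr_mx P)^T I L]mxE [metric_matrix _ L K]mxE.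
Qed.

Definition density_mx G : R := Num.sqrt `|\det (metric_matrix G)|.

Lemma density_mx_congr P G : P \in unitmx -> G \in unitmx ->
  density_mx G = `|\det (congr_mx P)| * density_mx (P *m G *m P^T).
Proof.
move=> uP uG; rewrite /density_mx (metric_matrix_congr uP uG) !det_mulmx det_tr.
by rewrite mulrAC -expr2 normrM sqrtrM// normrX sqrtr_sqr normr_id.
Qed.

End metric_on_matrices.

Section natural_metric_components.
Variables (R : realType) (V : vectType R) (p p' : nat) (h : (p + p' = \dim {:V})%N).
Local Notation n := (\dim {:V}).
Variables (v : n.-tuple V) (bv : basis_of {:V} v).

Lemma gram_coord_vector I : gram v (coord_vector v I) = coord_mx I.
Proof.
have sT : (gram v (coord_vector v I))^T = gram v (coord_vector v I).
  apply/matrixP => i j; rewrite !mxE /coord_vector; case: (enum_val I) => k l.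
  case: eqP => [->|_]; first by rewrite mulrC.
  by rewrite addrC; congr (_ + _); rewrite mulrC.
rewrite -[LHS](mx_coordsK sT); congr sym_mx; apply: eq_from_tnth => J.
by rewrite !tnth_mktuple coord_vectorE.
Qed.

Lemma metric_componentsE (g : Gamma h) :
  metric_components v g = metric_matrix (gram v (form_of g)).
Proof.
apply/matrixP => I J; rewrite !mxE /natural_metric !gram_coord_vector.
by rewrite mx_metricE.
Qed.

Definition density (g : Gamma h) : R := Num.sqrt `|\det (metric_components v g)|.

Lemma densityE g : density g = density_mx (gram v (form_of g)).
Proof. by rewrite /density metric_componentsE. Qed.

Lemma density_ge0 g : 0 <= density g.
Proof. exact: sqrtr_ge0. Qed.

Lemma density_continuous : continuous density.
Proof.
move=> g; apply: (@continuous_comp _ _ _ (fun g => `|\det (metric_components v g)|) Num.sqrt).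
  apply: (@continuous_comp _ _ _ (fun g => \det (metric_components v g)) (fun x : R => `|x|)).
    apply: continuous_det => I J; under [X in continuous X]funext do rewrite mxE.
    apply: continuous_sum => i; apply: continuous_sum => j.
    apply: continuous_sum => k; apply: continuous_sum => l.
    have cinv a b : continuous (fun g : Gamma h => invmx (gram v (form_of g)) a b).
      apply: continuous_invmx => [g'|c d]; first exact: gram_unitmx.
      under [X in continuous X]funext do rewrite mxE.
      exact: form_of_eval_continuous.
    apply: continuous_mul; last exact: cst_continuous.
    by apply: continuous_mul.
  exact: norm_continuous.
exact: sqrt_continuous.
Qed.

End natural_metric_components.

(** * Borel sets in coordinates *)

Section boxes.
Context {R : realType} {m : nat}.
Local Notation mR := (measurableTypeR R).
Implicit Types (c r : 'rV[R]_m) (e : R).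

(** A closed ball of the sup norm when [e >= 0]: compact as a set of rows, and a product of
    intervals, hence measurable as a set of tuples. *)
Definition box c e : set 'rV[R]_m := [set r | forall i, `|c ord0 i - r ord0 i| <= e].

Lemma boxE c e : box c e =
  [set r | forall i, (r ord0 i) \in `[c ord0 i - e, c ord0 i + e]].
Proof.
apply/seteqP; split=> r /= H i; have := H i; rewrite in_itv /= ler_distlC.
  by rewrite lerBlDr andbC -lerBlDr.
by rewrite lerBlDr andbC -lerBlDr.
Qed.

Lemma box_compact c e : compact (box c e).
Proof.
rewrite boxE; apply: (@rV_compact R m (fun i => `[c ord0 i - e, c ord0 i + e]%classic)).
by move=> i; exact: segment_compact.
Qed.

Lemma ball_box c e : ball c e `<=` box c e.
Proof. by move=> r [_ cr] i; exact/ltW/(cr ord0 i). Qed.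

Lemma box_ball c e e' : 0 < e' -> e < e' -> box c e `<=` ball c e'.
Proof.
move=> e0 ee' r cr; split=> // i j; rewrite !ord1.
exact: le_lt_trans (cr j) ee'.
Qed.

Lemma measurable_box c e : measurable (row_of_tuple @^-1` box c e : set (m.-tuple mR)).
Proof.
rewrite (_ : _ @^-1` _ = \bigcap_(i in [set: 'I_m])
    ((fun x : m.-tuple mR => tnth x i) @^-1` `[c ord0 i - e, c ord0 i + e])).
  apply: fin_bigcap_measurable => [|i _]; first exact: finite_finset.
  rewrite -[X in measurable X]setTI.
  by apply: measurable_tnth => //; exact: measurable_itv.
by rewrite boxE; apply/seteqP; split=> x /= H i => [_|];
  have := H i; rewrite !mxE; exact.
Qed.

Lemma lebesgue_box c e : 0 <= e ->
  (lebesgue_tuple R m (row_of_tuple @^-1` box c e) < +oo)%E.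
Proof.
move=> e0; pose a := [tuple c ord0 i - e | i < m]; pose b := [tuple c ord0 i + e | i < m].
rewrite (_ : _ @^-1` _ = [set x | forall i, tnth x i \in `[tnth a i, tnth b i]]).
  rewrite lebesgue_tuple_box.
  suff : (\prod_(i < m) lebesgue_measure (`[tnth a i, tnth b i] : set mR))%E \is a fin_num.
    by move=> ?; rewrite ltey_eq; apply/orP; left.
  elim/big_ind: _ => // [x y xf yf|i _]; first exact: fin_numM.
  by rewrite lebesgue_measure_itv /= lte_fin; case: ifPn.
by rewrite boxE; apply/seteqP; split=> x /= H i;
  have := H i; rewrite !mxE /a /b !tnth_mktuple.
Qed.

(** Boxes with rational centres and radii [1 / (k + 1)] are countably many. Both versions are
    needed: the open one for covers by open sets of finite measure, the closed one for compactness
    and measurability. *)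
Lemma open_bigcup_boxes (W : set 'rV[R]_m) : open W ->
  exists O C : (set 'rV[R]_m)^nat, [/\ forall i, open (O i),
    forall i, C i = set0 \/ exists c e, 0 <= e /\ C i = box c e,
    forall i, O i `<=` C i, W = \bigcup_i O i & W = \bigcup_i C i].
Proof.
move=> oW; pose cen (q : m.-tuple rat) : 'rV[R]_m := \row_i ratr (tnth q i).
pose rad (k : nat) : R := k.+1%:R^-1.
have rad0 k : 0 < rad k by rewrite invr_gt0.
(* An index that decodes to no box inside [W] will contribute the empty set. *)
pose P (i : nat) (qk : m.-tuple rat * nat) :=
  unpickle i = Some qk /\ box (cen qk.1) (rad qk.2) `<=` W.
pose O i : set 'rV[R]_m := [set r | exists qk, P i qk /\ ball (cen qk.1) (rad qk.2) r].
pose C i : set 'rV[R]_m := [set r | exists qk, P i qk /\ box (cen qk.1) (rad qk.2) r].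
have OC i : O i `<=` C i.
  by move=> r [qk [Pi br]]; exists qk; split=> //; exact: ball_box.
have WO : W `<=` \bigcup_i O i.
  move=> r Wr; move: (oW); rewrite openE => /(_ _ Wr); rewrite /interior /=.
  move=> /nbhs_ballP[e /= e0 eW].
  (* The centre will lie within [rad k] of [r], so the box of radius [rad k] stays within
     [2 * rad k < e] of [r]. *)
  have [k ke] : exists k, rad k < e / 2.
    have /cvgrPdist_lt/(_ (e / 2)) := @cvg_harmonic R.
    rewrite divr_gt0// => /(_ isT)[k _ H]; exists k.
    by have := H k (leqnn k); rewrite /= sub0r normrN ger0_norm.
  have qP i : exists q : rat, ratr q \in `](r ord0 i - rad k), (r ord0 i + rad k)[.
    have := @rat_in_itvoo R (r ord0 i - rad k) (r ord0 i + rad k).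
    by apply; have := rad0 k; lra.
  have /choice[q qr] := qP.
  pose qt := [tuple q i | i < m].
  have rball : ball (cen qt) (rad k) r.
    split=> // i j; rewrite !ord1 !mxE tnth_mktuple /ball /=.
    have := qr j; rewrite in_itv /= => /andP[h1 h2].
    by rewrite ltr_norml; apply/andP; split; lra.
  exists (pickle (qt, k)) => //; exists (qt, k); split=> //; split.
    by rewrite pickleK.
  move=> s sb; apply: eW; split=> // i j; rewrite !ord1 /ball /=.
  have [_ /(_ ord0 j)] := rball; rewrite /ball /= => h1.
  have := sb j => h2; have := ler_distD (cen qt ord0 j) (r ord0 j) (s ord0 j).
  rewrite [X in _ <= X + _ -> _]distrC => h3.
  apply: le_lt_trans h3 _; rewrite (splitr e); apply: ltrD.
    exact: lt_trans h1 ke.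
  exact: le_lt_trans h2 ke.
have CW : \bigcup_i C i `<=` W by move=> r [i _ [qk [[_ sW] br]]]; exact: sW.
exists O, C; split=> //.
- move=> i; case E : (unpickle i) => [qk|].
    have [sW|nW] := pselect (box (cen qk.1) (rad qk.2) `<=` W).
      rewrite (_ : O i = ball (cen qk.1) (rad qk.2)); first exact: ball_open.
      apply/seteqP; split=> [r [qk' [[E' _]]]|r br]; last by exists qk; split.
      by move: E'; rewrite E => -[<-].
    rewrite (_ : O i = set0); first exact: open0.
    rewrite -subset0 => r [qk' [[E' s]]]; move: E'; rewrite E => -[E'].
    by rewrite -E' in s.
  rewrite (_ : O i = set0); first exact: open0.
  by rewrite -subset0 => r [qk' [[E' s]]]; move: E'; rewrite E.
- move=> i; have [->|/set0P[r0 [qk [Pi br]]]] := eqVneq (C i) set0; first by left.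
  right; exists (cen qk.1), (rad qk.2); split; first exact: ltW.
  apply/seteqP; split=> [r [qk' [[E' _]]]|r br']; last by exists qk; split.
  by move: E'; rewrite Pi.1 => -[<-].
- apply/seteqP; split=> // r [i _ Oi]; apply: CW; exists i => //; exact: OC.
- apply/seteqP; split=> // r /WO[i _ Oi]; exists i => //; exact: OC.
Qed.

Lemma measurable_open_rV (W : set 'rV[R]_m) : open W ->
  measurable (row_of_tuple @^-1` W : set (m.-tuple mR)).
Proof.
move=> /open_bigcup_boxes[B [C [_ CE _ _ WE]]].
rewrite WE preimage_bigcup; apply: bigcup_measurable => i _.
by have [->|[c [e [_ ->]]]] := CE i; [rewrite preimage_set0|exact: measurable_box].
Qed.

End boxes.

Section chart_inverse.
Variables (R : realType) (V : vectType R) (p p' : nat) (h : (p + p' = \dim {:V})%N).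
Local Notation n := (\dim {:V}).
Local Notation N := #|le_pairs n|.
Local Notation mR := (measurableTypeR R).
Variables (v : n.-tuple V) (bv : basis_of {:V} v).

Local Notation phi := (coords (h := h) v).
Local Notation psi := (chart (h := h) v).

Definition uncoords : N.-tuple R -> Gamma h := pinv [set: Gamma h] phi.

Lemma coordsK : cancel phi uncoords.
Proof.
have I : {in [set: Gamma h] &, injective phi}.
  by move=> x y _ _; exact: coords_inj.
by move=> g; apply: (pinvKV _ I); rewrite inE.
Qed.

(** On the chart image the preimage is the image under the inverse, which is continuous there
    because the chart is open. *)
Lemma chart_preimage_compact (K : set 'rV[R]_N) :
  compact K -> K `<=` range psi -> compact (psi @^-1` K).
Proof.
move=> cK KW; pose u r := uncoords (tuple_of_row r).
have uK : cancel psi u by move=> g; rewrite /u row_of_tupleK coordsK.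
rewrite (_ : _ @^-1` _ = u @` K); last first.
  apply/seteqP; split=> [g Kg|_ [r Kr <-]]; first by exists (psi g).
  by have [g _ gr] := KW _ Kr; rewrite -gr uK /preimage /= gr.
apply: continuous_compact => //; apply: continuous_in_subspaceT => r /set_mem/KW[g _ <-].
move=> U; rewrite uK nbhsE => -[B [oO Og] OU].
rewrite nbhs_simpl /=; have := chart_open bv oO; rewrite openE => /(_ (psi g)).
move=> /(_ _)/filterS; apply; last by exists g.
by move=> _ [g' Og' <-]; rewrite /= uK; exact: OU.
Qed.

Lemma coords_image (A : set (Gamma h)) : phi @` A = range phi `&` uncoords @^-1` A.
Proof.
apply/seteqP; split=> [_ [g Ag <-]|_ [[g _ <-]]] /=; last by rewrite coordsK => Ag; exists g.
by split; [exists g|rewrite /= coordsK].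
Qed.

(** By injectivity, images commute with complements relative to the measurable range, so the sets
    with measurable image form a sigma-algebra; it contains the open sets since the chart is
    open. *)
Lemma measurable_coords_image (A : set (borel_Gamma h)) : measurable A ->
  measurable (phi @` A : set (N.-tuple mR)).
Proof.
have mopen (U : set (Gamma h)) : open U -> measurable (phi @` U : set (N.-tuple mR)).
  move=> oU; rewrite (_ : _ @` _ = row_of_tuple @^-1` (psi @` U)).
    by apply: measurable_open_rV; exact: chart_open.
  apply/seteqP; split=> [_ [g Ug <-]|t [g Ug gt]]; first by exists g.
  by exists g => //; exact: (can_inj row_of_tupleK).
have minj : injective phi by exact: coords_inj.
move: A; apply: smallest_sub => //; split=> [|A mA|A mA].
- by rewrite /= image_set0.
- rewrite (_ : _ @` _ = range phi `\` phi @` A).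
    by apply: measurableD => //; exact: mopen openT.
  apply/seteqP; split=> [_ [g [_ nA] <-]|_ [[g _ <-]] nA].
    by split; [exists g|move=> [g' Ag' /minj E]; apply: nA; rewrite -E].
  by exists g => //; split=> // Ag; apply: nA; exists g.
- by rewrite /= image_bigcup; apply: bigcup_measurable.
Qed.

Lemma continuous_borel_measurable (f : Gamma h -> R) : continuous f ->
  measurable_fun setT (f : borel_Gamma h -> R).
Proof.
move=> /continuousP cf; apply: (measurability _ (RGenOpens.measurableE R)).
move=> _ [_ [a [b ->] <-]]; rewrite setTI; apply: sub_sigma_algebra.
exact/cf/interval_open.
Qed.

Lemma measurable_uncoords d (T : measurableType d) (A : set (borel_Gamma h))
    (f : borel_Gamma h -> T) : measurable A -> measurable_fun A f ->
  measurable_fun (phi @` A : set (N.-tuple mR)) (f \o uncoords).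
Proof.
move=> mA mf _ Y mY; rewrite (_ : _ `&` _ = phi @` (A `&` f @^-1` Y)).
  by apply: measurable_coords_image; exact: mf.
apply/seteqP; split=> [_ [[g Ag <-]] /=|_ [g [Ag fg] <-]].
  by rewrite coordsK => fg; exists g.
by split; [exists g|rewrite /= coordsK].
Qed.

End chart_inverse.

(** * The natural measure *)

Section explicit_measure.
Variables (R : realType) (V : vectType R) (p p' : nat) (h : (p + p' = \dim {:V})%N).
Local Notation n := (\dim {:V}).
Local Notation N := #|le_pairs n|.
Local Notation mR := (measurableTypeR R).
Variables (v : n.-tuple V) (bv : basis_of {:V} v).
Local Notation phi := (coords (h := h) v).
Local Notation q := (uncoords h v).
Local Notation leb := (lebesgue_tuple R N).

(** The basis proof is an argument so that the measure structure can be attached to the term: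
    additivity needs disjoint sets to have disjoint images, that is, injective coordinates. *)
Definition density_measure (_ : basis_of {:V} v) (A : set (borel_Gamma h)) : \bar R :=
  (\int[leb]_(x in phi @` A) (density v (q x))%:E)%E.

Lemma measurable_density_uncoords (A : set (borel_Gamma h)) : measurable A ->
  measurable_fun (phi @` A : set (N.-tuple mR)) (fun x => (density v (q x))%:E).
Proof.
move=> mA; apply: (measurable_uncoords bv (f := fun g => (density v g)%:E) mA).
apply/measurable_EFinP; apply: measurable_funTS.
by apply: continuous_borel_measurable; exact: density_continuous.
Qed.

Let density_measure0 : density_measure bv set0 = 0%E.
Proof. by rewrite /density_measure image_set0 integral_set0. Qed.

Let density_measure_ge0 A : (0 <= density_measure bv A)%E.
Proof. by apply: integral_ge0 => x _; rewrite lee_fin density_ge0. Qed.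

Let density_measure_sigma_additive : semi_sigma_additive (density_measure bv).
Proof.
move=> F mF tF mUF; rewrite /density_measure; apply: cvg_toP.
  apply: ereal_nondecreasing_is_cvgn => a b ab.
  by apply: lee_sum_nneg_natr => // k _ _; exact: density_measure_ge0.
rewrite image_bigcup ge0_integral_bigcup//=.
- by move=> i; exact: measurable_coords_image.
- by rewrite -image_bigcup; exact: measurable_density_uncoords.
- by move=> x _; rewrite lee_fin density_ge0.
- apply/trivIsetP => i j _ _ ij; rewrite -subset0 => _ [[g Fg <-] [g' Fg' /(coords_inj bv) E]].
  move: Fg'; rewrite E => Fg'.
  by have /trivIsetP/(_ i j I I ij) := tF; rewrite -subset0 => /(_ g); apply.
Qed.

HB.instance Definition _ := isMeasure.Build _ _ _ (density_measure bv)
  density_measure0 density_measure_ge0 density_measure_sigma_additive.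

Lemma density_measureE (A : set (borel_Gamma h)) : density_measure bv A =
  (\int[leb]_(x in range phi) (\1_A (q x) * density v (q x))%:E)%E.
Proof.
rewrite /density_measure (coords_image bv A) integral_mkcondr; apply: eq_integral => x _.
rewrite patchE indicE (_ : (x \in q @^-1` A) = (q x \in A)).
  by case: ifP => _; rewrite ?mul1r ?mul0r.
by apply/idP/idP; rewrite !inE.
Qed.

Import HBNNSimple.

Let mD : measurable (range phi : set (N.-tuple mR)).
Proof. exact: measurable_coords_image. Qed.

(** For indicators this is the definition of the measure; simple functions follow by linearity, and
    monotone convergence on both sides gives the general case. *)
Lemma integral_density_measure (f : borel_Gamma h -> \bar R) :
  measurable_fun setT f -> (forall g, 0 <= f g)%E ->
  (\int[density_measure bv]_g f g =
   \int[leb]_(x in range phi) (f (q x) * (density v (q x))%:E))%E.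
Proof.
move=> mf f0.
pose f_ := nnsfun_approx measurableT mf.
have mq d (T : measurableType d) (k : borel_Gamma h -> T) : measurable_fun setT k ->
  measurable_fun (range phi : set (N.-tuple mR)) (k \o q).
  by move=> mk; exact: measurable_uncoords.
have mw := measurable_density_uncoords (@measurableT _ (borel_Gamma h)).
transitivity (limn (fun k => \int[density_measure bv]_g (f_ k g)%:E))%E.
  rewrite -monotone_convergence//.
  - apply: eq_integral => y _; apply/esym/cvg_lim => //.
    by apply: cvg_nnsfun_approx => // *; exact: f0.
  - by move=> k; exact/measurable_EFinP/measurable_funP.
  - by move=> k y _; rewrite lee_fin.
  - by move=> y _ a b ab; rewrite lee_fin; exact/lefP/nd_nnsfun_approx.
transitivity (limn (fun k => \int[leb]_(x in range phi)
    ((f_ k (q x))%:E * (density v (q x))%:E)))%E; last first.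
  rewrite -monotone_convergence//.
  - apply: eq_integral => x _; apply/cvg_lim => //.
    by apply: cvgeZr => //; apply: cvg_nnsfun_approx => // *; exact: f0.
  - move=> k; apply: emeasurable_funM => //.
    apply: (mq _ _ (fun g => (f_ k g)%:E)).
    exact/measurable_EFinP/measurable_funP.
  - by move=> k y _; rewrite mule_ge0// lee_fin// density_ge0.
  - move=> y _ a b ab; apply: lee_wpmul2r; first by rewrite lee_fin density_ge0.
    by rewrite lee_fin; have /lefP := nd_nnsfun_approx measurableT mf ab; exact.
congr (limn _); apply/funext => k; move: (f_ k) => g {f_}.
under eq_integral do rewrite fimfunE -fsumEFin//.
rewrite ge0_integral_fsum//; last 2 first.
- by move=> y; exact/measurable_EFinP/measurable_funM.
- by move=> y x _; rewrite nnfun_muleindic_ge0.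
have mB r : measurable (g @^-1` [set r] : set (borel_Gamma h)) by [].
have m1w r : measurable_fun (range phi : set (N.-tuple mR))
    (fun x => (\1_(g @^-1` [set r]) (q x) * density v (q x))%:E).
  apply: (mq _ _ (fun g' => (\1_(g @^-1` [set r]) g' * density v g')%:E)).
  apply/measurable_EFinP; apply: measurable_funM; first exact: measurable_indic.
  by apply: continuous_borel_measurable; exact: density_continuous.
have w0 r x : (0 <= (\1_(g @^-1` [set r]) (q x) * density v (q x))%:E)%E.
  by rewrite lee_fin mulr_ge0// density_ge0.
have g0 r : range g r -> 0 <= r by move=> [x _ <-].
transitivity (\sum_(r \in range g) \int[leb]_(x in range phi)
   (r%:E * (\1_(g @^-1` [set r]) (q x) * density v (q x))%:E))%E.
  apply: eq_fsbigr => r /set_mem rg; rewrite integralZl_indic_nnsfun// integral_indic//= setIT.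
  by rewrite ge0_integralZl_EFin// ?density_measureE// g0.
rewrite -ge0_integral_fsum//.
- apply: eq_integral => x _.
  rewrite fsumEFin// -EFinM fimfunE mulr_fsuml//; congr (_%:E).
  by apply: eq_fsbigr => r _; rewrite mulrA.
- by move=> r; apply: measurable_funeM.
- move=> r x _; rewrite EFinM muleA mule_ge0//; first exact: nnfun_muleindic_ge0.
  by rewrite lee_fin density_ge0.
Qed.

End explicit_measure.

Section density_measure_regular.
Variables (R : realType) (V : vectType R) (p p' : nat) (h : (p + p' = \dim {:V})%N).
Local Notation n := (\dim {:V}).
Local Notation N := #|le_pairs n|.
Local Notation mR := (measurableTypeR R).
Variables (v : n.-tuple V) (bv : basis_of {:V} v).
Local Notation phi := (coords (h := h) v).
Local Notation psi := (chart (h := h) v).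
Local Notation q := (uncoords h v).
Local Notation leb := (lebesgue_tuple R N).
Local Notation mu := (@density_measure R V p p' h v bv).

Lemma compact_borel (K : set (Gamma h)) : compact K -> measurable (K : set (borel_Gamma h)).
Proof.
move=> cK; apply: borel_closed; apply: compact_closed => //.
exact: (Gamma_hausdorff bv).
Qed.

Lemma compact_continuous_bounded (f : Gamma h -> R) (K : set (Gamma h)) :
  continuous f -> compact K ->
  exists M, forall g, K g -> `|f g| <= M.
Proof.
move=> cf cK; have : compact (f @` K).
  by apply: continuous_compact => //; exact: continuous_subspaceT.
move=> /compact_bounded[M [_ HM]]; exists (M + 1) => g Kg.
by apply: (HM (M + 1)); [rewrite ltrDl|exists g].
Qed.

Lemma compact_chart_box (K : set (Gamma h)) : compact K ->
  exists2 M, 0 <= M & psi @` K `<=` box 0 M.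
Proof.
move=> cK; have : compact (psi @` K).
  by apply: continuous_compact => //; apply: continuous_subspaceT; exact: chart_continuous.
move=> /compact_bounded[M [_ HM]]; pose M' := `|M| + 1.
have M'0 : 0 < M' by rewrite ltr_wpDl.
exists (M' + 1) => [|r Kr]; first by rewrite addr_ge0// ltW.
apply: ball_box; rewrite -ball_normE /= sub0r normrN.
apply: (@le_lt_trans _ _ M'); last by rewrite ltrDl.
apply: (HM M') => //; rewrite /M'; apply: le_lt_trans (ler_norm _) _; by rewrite ltrDl.
Qed.

(** The density is bounded on [K], and the coordinates of [K] lie in a box of finite Lebesgue
    measure. *)
Lemma density_measure_compact (K : set (Gamma h)) : compact K -> (mu K < +oo)%E.
Proof.
move=> cK; have mK := compact_borel cK.
have [M KM] := compact_continuous_bounded (density_continuous bv) cK.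
have [B B0 KB] := compact_chart_box cK.
apply: (@le_lt_trans _ _ (\int[leb]_(x in phi @` K) `|M|%:E)%E).
  apply: ge0_le_integral => //.
  - exact: measurable_coords_image.
  - by move=> x _; rewrite lee_fin density_ge0.
  - exact: measurable_density_uncoords.
  - move=> _ [g Kg <-]; rewrite coordsK// lee_fin.
    by apply: le_trans (ler_norm _) _; apply: le_trans (KM _ Kg) (ler_norm _).
rewrite integral_cst; last exact: measurable_coords_image.
apply: lte_mul_pinfty => //; apply: le_lt_trans (lebesgue_box 0 B0).
apply: le_measure; rewrite ?inE.
- exact: measurable_coords_image.
- exact: measurable_box.
- by move=> _ [g Kg <-]; apply: KB; exists g.
Qed.

Lemma Gamma_open_sigma_compact (U : set (Gamma h)) : open U ->
  exists C : (set (Gamma h))^nat, (forall i, compact (C i)) /\ U = \bigcup_i C i.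
Proof.
move=> oU; have [_ [C [_ CE _ _ WC]]] := open_bigcup_boxes (chart_open bv oU).
exists (fun i => psi @^-1` (C i)); split=> [i|].
  apply: chart_preimage_compact => //.
    by have [->|[c [e [_ ->]]]] := CE i; [exact: compact0|exact: box_compact].
  move=> r Cr; have [g _ <-] : (psi @` U) r by rewrite WC; exists i.
  by exists g.
apply/seteqP; split=> [g Ug|g [i _ Cg]].
  have [i _ Ci] : (\bigcup_i C i) (psi g) by rewrite -WC; exists g.
  by exists i.
have [g' Ug' E] : (psi @` U) (psi g) by rewrite WC; exists i.
by rewrite -(chart_inj bv E).
Qed.

Lemma density_measure_regular : regular_borel mu.
Proof.
(* Each open piece sits inside a compact box within the chart image, so its preimage has finite
   measure: this is the cover required for regularity. *)
have [B [C [oB CE BC WB WC]]] := open_bigcup_boxes (range_chart_open (h := h) bv).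
have CW i : C i `<=` range psi by move=> r Cr; rewrite WC; exists i.
have cC i : compact (psi @^-1` C i).
  apply: chart_preimage_compact => //.
  by have [->|[c [e [_ ->]]]] := CE i; [exact: compact0|exact: box_compact].
pose O i := psi @^-1` B i.
have oO i : open (O i).
  by apply: open_comp => // g _; exact: chart_continuous.
have Ooo i : (mu (O i) < +oo)%E.
  apply: le_lt_trans (density_measure_compact (cC i)).
  apply: le_measure; rewrite ?inE; [exact: borel_open|exact: compact_borel|].
  by move=> g; exact: BC.
have Ocov : \bigcup_i O i = setT.
  apply/seteqP; split=> // g _; have [i _ Bi] : (\bigcup_i B i) (psi g) by rewrite -WB; exists g.
  by exists i.
have hT : hausdorff_space (Gamma h) by exact: (Gamma_hausdorff bv).
split; first exact: density_measure_compact.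
- move=> A mA.
  exact: (@borel_outer_regular R (Gamma h) mu O oO Ooo Ocov hT
    Gamma_open_sigma_compact A mA).
- move=> A mA.
  exact: (@borel_inner_regular R (Gamma h) mu O oO Ooo Ocov hT
    Gamma_open_sigma_compact A mA).
Qed.

Lemma density_measure_spec : natural_measure_spec v mu.
Proof.
split; first exact: density_measure_regular.
move=> f cf _; have mf : measurable_fun setT (fun g : borel_Gamma h => (f g)%:E).
  by apply/measurable_EFinP; exact: continuous_borel_measurable.
(* The integral formula is for nonnegative functions; as the density is nonnegative, multiplying by
   it commutes with taking positive and negative parts. *)
rewrite [LHS]integralE [RHS]integralE; congr (_ - _)%E.
  rewrite integral_density_measure//; last exact: measurable_funepos.
  apply: eq_integral => x _; rewrite !funeposE /= -!EFin_max -EFinM.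
  by rewrite maxr_pMl ?mul0r// density_ge0.
rewrite integral_density_measure//; last exact: measurable_funeneg.
apply: eq_integral => x _; rewrite !funenegE /= -!EFin_max -EFinM.
by rewrite -mulNr maxr_pMl ?mul0r// density_ge0.
Qed.

End density_measure_regular.

(** * Change of basis *)

Section change_of_basis.
Variables (R : realType) (V : vectType R) (p p' : nat) (h : (p + p' = \dim {:V})%N).
Local Notation n := (\dim {:V}).
Local Notation N := #|le_pairs n|.
Local Notation mR := (measurableTypeR R).
Local Notation leb := (lebesgue_tuple R N).

Definition coord_integral (v : n.-tuple V) (f : Gamma h -> R) : \bar R :=
  (\int[leb]_(x in range (coords (h := h) v))
     ((fun g => f g * density v g) (uncoords h v x))%:E)%E.

Lemma coord_integral_basis (v w : n.-tuple V) (f : Gamma h -> R) :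
  basis_of {:V} v -> basis_of {:V} w -> continuous f -> (forall g, 0 <= f g) ->
  coord_integral v f = coord_integral w f.
Proof.
move=> bv bw cf f0; pose P : 'M[R]_n := \matrix_(i, j) coord v j (tnth w i).
have wE i : tnth w i = \sum_j P i j *: tnth v j.
  by rewrite {1}(tuple_basisE bv (tnth w i)); apply: eq_bigr => j _; rewrite mxE.
have gramP (g : Gamma h) : gram w (form_of g) = P *m gram v (form_of g) *m P^T.
  by apply: gram_change => //; exact: form_of_bilinear.
have uP : P \in unitmx.
  (* [P] is a factor of a Gram matrix of any point of [Gamma], which is nonempty. *)
  have := gram_unitmx bw (point : Gamma h).
  by rewrite gramP !unitmx_mul => /andP[/andP[]].
set L := congr_mx P; have uL : L \in unitmx by exact: congr_mx_unit.
have coordsL (g : Gamma h) : coords w g = linear_tuple L (coords v g).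
  by rewrite congr_mxE sym_mx_coords -gramP.
have L_inj : injective (linear_tuple L).
  move=> s t st; rewrite -(linear_tuple1 s) -(linear_tuple1 t).
  by rewrite -(mulVmx uL) !linear_tupleM st.
have densL (g : Gamma h) : density v g = `|\det L| * density w g.
  by rewrite !densityE// (density_mx_congr uP (gram_unitmx bv g)) -gramP.
(* The linear change of variables concerns functions on the whole space, so the integrand is
   extended by zero off the chart image. *)
pose F u : N.-tuple mR -> \bar R :=
  (fun x => (f (uncoords h u x) * density u (uncoords h u x))%:E) \_ (range (coords (h := h) u)).
have mF (u : n.-tuple V) : basis_of {:V} u -> measurable_fun setT (F u).
  move=> bu; apply/(measurable_restrictT _ _).1.
    exact: (measurable_coords_image bu (@measurableT _ (borel_Gamma h))).
  apply: (measurable_uncoords bu (f := fun g : borel_Gamma h => (f g * density u g)%:E)) => //.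
  apply/measurable_EFinP; apply: measurable_funM; apply: continuous_borel_measurable => //.
  exact: density_continuous.
have F0 u x : (0 <= F u x)%E.
  by apply: erestrict_ge0 => t _; rewrite lee_fin mulr_ge0// density_ge0.
have IE u : coord_integral u f = (\int[leb]_x F u x)%E by rewrite /coord_integral integral_mkcond.
rewrite !IE -(linear_change_of_variables uL (mF w bw) (F0 w)).
rewrite -ge0_integralZl_EFin//; last first.
  by apply: measurableT_comp; [exact: mF|exact: measurable_linear_tuple].
apply: eq_integral => t _; rewrite /F !patchE.
have [/[!inE] -[g _ <-]|nt] := boolP (t \in range (coords (h := h) v)).
  rewrite ifT; last by rewrite inE; exists g.
  rewrite -coordsL !coordsK// -EFinM densL; congr (_%:E); ring.
(* Both sides vanish here: as [L] is injective, a point outside the image for [v] goes outside the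
   image for [w]. *)
rewrite ifF ?mule0//; apply/negP => /[!inE] -[g _ gt]; move/negP: nt; apply.
rewrite inE; exists g => //; apply: L_inj; by rewrite -coordsL.
Qed.

End change_of_basis.

(** * Compactly supported test functions *)

Section comparison.
Variables (R : realType) (V : vectType R) (p p' : nat) (h : (p + p' = \dim {:V})%N).
Local Notation n := (\dim {:V}).
Local Notation N := #|le_pairs n|.
Variables (v : n.-tuple V) (bv : basis_of {:V} v).
Local Notation psi := (chart (h := h) v).

(** Built from tents in the chart norm centred at finitely many points of [K]; each is supported in
    a box inside the chart image of [U], whose preimage is compact. *)
Lemma Gamma_bump (K U : set (Gamma h)) : compact K -> open U -> K `<=` U ->
  exists f : Gamma h -> R, [/\ continuous f, compact (closure [set g | f g != 0]),
    forall g, 0 <= f g, forall g, K g -> f g = 1 & forall g, f g <= \1_U g].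
Proof.
move=> cK oU KU; have oW := chart_open bv oU.
have rad g : exists e : R, 0 < e /\ (U g -> box (psi g) e `<=` psi @` U).
  (* The radius must be chosen for every point; outside [U] the value 1 is a placeholder. *)
  have [Ug|nUg] := pselect (U g); last by exists 1; split.
  move: oW; rewrite openE => /(_ (psi g)); rewrite /interior /= => /(_ _)/nbhs_ballP[|e e0 eW].
    by exists g.
  exists (e / 2); split=> [|_]; first by rewrite divr_gt0.
  by apply: subset_trans eW; apply: box_ball => //; rewrite ltr_pdivrMr// ltr_pMr// ltr1n.
have [e eP] := choice rad.
have e0 g : 0 < e g by have [] := eP g.
have eU g : U g -> box (psi g) (e g) `<=` psi @` U by have [] := eP g.
pose b g g' : R := Num.max 0 (1 - `|psi g - psi g'| / e g).
have cb g : continuous (b g).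
  move=> x; apply: (@continuous_max _ _ (fun=> 0) (fun g' => 1 - `|psi g - psi g'| / e g)).
    exact: cst_continuous.
  apply: continuousB; first exact: cst_continuous.
  apply: continuousM; last exact: cst_continuous.
  apply: (@continuous_comp _ _ _ (fun g' => psi g - psi g') (fun r => `|r|));
    last exact: norm_continuous.
  apply: continuousB; first exact: cst_continuous.
  exact: chart_continuous.
have bbox g g' : b g g' != 0 -> box (psi g) (e g) (psi g').
  apply: contra_neqP => nbox; apply/max_idPl; rewrite subr_le0 ler_pdivlMr// mul1r leNgt.
  apply/negP => lt_e; apply: nbox; apply: ball_box.
  by rewrite -ball_normE.
have b0 g g' : 0 <= b g g' by rewrite /b le_max lexx.
pose B g := psi @^-1` ball (psi g) (e g / 2).
have oB g : open (B g).
  by apply: open_comp => [x _|]; [exact: chart_continuous|exact: ball_open].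
have : cover_compact K by rewrite -compact_cover.
move=> /(_ (Gamma h) K B (fun g _ => oB g))[|D0 DK0 KD0].
  by move=> g Kg; exists g => //; apply: ballxx; rewrite divr_gt0.
pose D : seq (Gamma h) := finmap.enum_fset D0.
have DK g : g \in D -> K g by move=> gD; apply/set_mem; exact: DK0.
have KD g' : K g' -> exists2 g, g \in D & B g g' by move=> /KD0[g gD Bg]; exists g.
(* On the half-radius ball [B g] the tent [b g] is at least 1/2, so the doubled sum is at least 1 on
   [K]; the minimum caps it at 1. *)
pose f g' : R := Num.min 1 (2 * \sum_(g <- D) b g g').
have f0 g' : 0 <= f g' by rewrite le_min ler01 mulr_ge0// sumr_ge0.
pose Z := \big[setU/set0]_(g <- D) (psi @^-1` box (psi g) (e g)).
have DU g : g \in D -> U g by move=> /DK/KU.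
have cZ : compact Z.
  rewrite /Z big_seq; apply: bigsetU_compact => g /DU Ug.
  apply: chart_preimage_compact => //; first exact: box_compact.
  by move=> r /(eU _ Ug)[g' _ <-]; exists g'.
have ZE : Z = \bigcup_(g in [set` D]) (psi @^-1` box (psi g) (e g)).
  by rewrite bigcup_seq.
have ZU : Z `<=` U.
  rewrite ZE => g' [g /= /DU Ug /(eU _ Ug)[g'' Ug'' E]].
  by rewrite -(chart_inj bv E).
have fZ : [set g | f g != 0] `<=` Z.
  move=> g' /=; apply: contra_neqP => nZ; rewrite /f big_seq big1 ?mulr0.
    by apply/min_idPr.
  move=> g gD; apply/eqP; apply: contra_notT nZ => /bbox bx.
  by rewrite ZE; exists g.
exists f; split=> //.
- move=> x; apply: (@continuous_min _ _ (fun=> 1) (fun g' => 2 * \sum_(g <- D) b g g')).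
    exact: cst_continuous.
  apply: continuousM; first exact: cst_continuous.
  exact: continuous_sum.
- apply: (subclosed_compact _ cZ); first exact: closed_closure.
  have -> : Z = closure Z.
    by apply/closure_id; apply: compact_closed => //; exact: (Gamma_hausdorff bv).
  exact: closureS.
- move=> g' /KD[g gD]; rewrite /B /= -ball_normE /= => lt_e.
  apply/min_idPl; rewrite (big_rem g)//= mulrDr.
  apply: (@le_trans _ _ (2 * b g g')); last by rewrite lerDl mulr_ge0// sumr_ge0.
  rewrite -ler_pdivrMl// mulr1 le_max; apply/orP; right.
  have : `|psi g - psi g'| / e g <= 1 / 2.
    by rewrite ler_pdivrMr// mulrC mulrA mulr1 ltW.
  by lra.
- move=> g; rewrite indicE; have [gU|gU] := boolP (g \in U); first by rewrite ge_min lexx.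
  have [fg0|/fZ/ZU Ug] := eqVneq (f g) 0; first by rewrite fg0.
  by move/negP: gU; rewrite inE.
Qed.

End comparison.

(** * Invariance *)

Section linear_action.
Variables (R : realType) (V : vectType R) (p p' : nat) (h : (p + p' = \dim {:V})%N).
Local Notation n := (\dim {:V}).
Implicit Types (g : GL V) (x : Gamma h).

Lemma GL_inv_subproof g : lker (\val g)^-1%VF == 0%VS.
Proof. by apply/lker0P/can_inj/lker0_lfunVK; exact: (valP g). Qed.

Definition GL_inv g : GL V := exist _ (\val g)^-1%VF (GL_inv_subproof g).

Lemma GL_actE g x u w : form_of (GL_act g x) u w =
  form_of x ((\val g)^-1%VF u) ((\val g)^-1%VF w).
Proof. by []. Qed.

Lemma GL_invK g : (\val (GL_inv g))^-1%VF =1 \val g.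
Proof.
move=> u; have gK := lker0_lfunK (valP g); rewrite -{1}(gK u).
exact: (lker0_lfunK (valP (GL_inv g))).
Qed.

Lemma GL_actK g : cancel (@GL_act R V p p' h g) (GL_act (GL_inv g)).
Proof.
move=> x; apply: form_of_inj; apply/funext => u; apply/funext => w.
by rewrite !GL_actE !GL_invK !(lker0_lfunK (valP g)).
Qed.

Lemma GL_actVK g : cancel (@GL_act R V p p' h (GL_inv g)) (GL_act g).
Proof.
move=> x; apply: form_of_inj; apply/funext => u; apply/funext => w.
by rewrite !GL_actE !GL_invK !(lker0_lfunVK (valP g)).
Qed.

Lemma GL_act_continuous g : continuous (@GL_act R V p p' h g).
Proof. by apply: continuous_to_Gamma => u w; exact: form_of_eval_continuous. Qed.

Lemma GL_act_measurable g :
  measurable_fun setT (@GL_act R V p p' h g : borel_Gamma h -> borel_Gamma h).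
Proof.
apply: (@measurability _ _ (borel_Gamma h) (borel_Gamma h) setT _ (@open (Gamma h)) erefl).
move=> _ [U oU <-].
rewrite setTI; apply: borel_open; apply: open_comp => // x _.
exact: GL_act_continuous.
Qed.

Lemma basis_GL g (v : n.-tuple V) : basis_of {:V} v -> basis_of {:V} (map_tuple (\val g) v).
Proof.
move=> bv; have kg := valP g; have kg0 := eqP kg.
have /(@limg_basis_of _ _ _ (\val g) fullv v) : (fullv :&: lker (\val g) = 0)%VS.
  by rewrite kg0 capv0.
by rewrite (lker0_limgf kg); exact.
Qed.

Lemma gram_GL g (v : n.-tuple V) x :
  gram (map_tuple (\val g) v) (form_of (GL_act g x)) = gram v (form_of x).
Proof.
by apply/matrixP => i j; rewrite !mxE GL_actE !tnth_map !(lker0_lfunK (valP g)).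
Qed.

Lemma coords_GL g (v : n.-tuple V) x :
  coords (map_tuple (\val g) v) (GL_act g x) = coords v x.
Proof. by rewrite !coordsE gram_GL. Qed.

Lemma coord_integral_GL g (v : n.-tuple V) (f : Gamma h -> R) : basis_of {:V} v ->
  coord_integral v (f \o GL_act g) = coord_integral (map_tuple (\val g) v) f.
Proof.
move=> bv; have bgv := basis_GL g bv.
rewrite /coord_integral (_ : range (coords (map_tuple (\val g) v)) = range (coords (h := h) v)).
  apply: eq_integral => _ /set_mem[x _ <-].
  rewrite coordsK// -(coords_GL g) coordsK//=.
  by rewrite !densityE// gram_GL.
apply/seteqP; split=> [_ [x _ <-]|_ [x _ <-]].
  by exists (GL_act (GL_inv g) x) => //; rewrite -(coords_GL g) GL_actVK.
by exists (GL_act g x) => //; rewrite coords_GL.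
Qed.

(** The support lies in the image of that of [f] under the inverse of [g], compact and hence closed
    in a Hausdorff space. *)
Lemma compact_support_GL g (f : Gamma h -> R) :
  compact (closure [set x | f x != 0]) ->
  compact (closure [set x | (f \o GL_act g) x != 0]).
Proof.
set Z := closure _ => cZ; pose Z' := GL_act (GL_inv g) @` Z.
have cZ' : compact Z'.
  by apply: continuous_compact => //; apply: continuous_subspaceT; exact: GL_act_continuous.
apply: (subclosed_compact _ cZ'); first exact: closed_closure.
have -> : Z' = closure Z'.
  apply/closure_id; apply: compact_closed => //.
  exact: (Gamma_hausdorff (vbasisP {:V})).
apply: closureS => x fx; exists (GL_act g x); last exact: GL_actK.
exact: subset_closure.
Qed.

End linear_action.

(** * Uniqueness and invariance *)

Section uniqueness.
Variables (R : realType) (V : vectType R) (p p' : nat) (h : (p + p' = \dim {:V})%N).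
Local Notation n := (\dim {:V}).

(** A bump function between a compact [K] and [U] gives [mu K <= nu U] through the common coordinate
    integral. The hypotheses are asymmetric so that [nu] can be a pushforward, known only through
    its integrals. *)
Lemma natural_measure_le_open (v w : n.-tuple V)
    (mu nu : {measure set (borel_Gamma h) -> \bar R}) :
  basis_of {:V} v -> basis_of {:V} w -> natural_measure_spec v mu ->
  (forall f : Gamma h -> R, continuous f -> compact (closure [set x | f x != 0]) ->
    (forall x, 0 <= f x) -> (\int[nu]_x (f x)%:E = coord_integral w f)%E) ->
  forall U : set (Gamma h), open U -> (mu U <= nu U)%E.
Proof.
move=> bv bw [[_ _ mu_inner] mu_int] nu_int U oU.
have mU : measurable (U : set (borel_Gamma h)) by exact: borel_open.
rewrite mu_inner//; apply: ge_ereal_sup => _ [K [cK KU] <-].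
have mK := compact_borel bv cK.
have [f [cf sf f0 fK fU]] := Gamma_bump bv cK oU KU.
have mf : measurable_fun setT (fun x : borel_Gamma h => (f x)%:E).
  by apply/measurable_EFinP; exact: continuous_borel_measurable.
apply: (@le_trans _ _ (\int[mu]_x (f x)%:E)%E).
  rewrite -[X in mu X]setIT -integral_indic//; apply: ge0_le_integral => //.
  - by apply/measurable_EFinP; exact: measurable_indic.
  - move=> x _; rewrite lee_fin indicE; have [xK|_] := boolP (x \in K); last exact: f0.
    by rewrite fK//; exact: set_mem.
rewrite (mu_int f cf sf) [X in (X <= _)%E](_ : _ = coord_integral v f)//.
rewrite (coord_integral_basis bv bw)// -nu_int// -[X in nu X]setIT -integral_indic//.
apply: ge0_le_integral => //.
- by move=> x _; rewrite lee_fin f0.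
- by apply/measurable_EFinP; exact: measurable_indic.
- by move=> x _; rewrite lee_fin.
Qed.

Lemma natural_measure_unique (v w : n.-tuple V)
    (mu nu : {measure set (borel_Gamma h) -> \bar R}) :
  basis_of {:V} v -> basis_of {:V} w ->
  natural_measure_spec v mu -> natural_measure_spec w nu ->
  forall A : set (borel_Gamma h), measurable A -> mu A = nu A.
Proof.
move=> bv bw mu_spec nu_spec A mA.
have munu (U : set (Gamma h)) : open U -> mu U = nu U.
  move=> oU; apply/eqP; rewrite eq_le; apply/andP; split.
    apply: (natural_measure_le_open bv bw mu_spec) => // f cf sf _.
    exact: nu_spec.2.
  apply: (natural_measure_le_open bw bv nu_spec) => // f cf sf _.
  exact: mu_spec.2.
have [[_ mu_outer _] _] := mu_spec; have [[_ nu_outer _] _] := nu_spec.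
rewrite mu_outer// nu_outer//; congr ereal_inf.
by apply/seteqP; split=> [_ [U [oU AU] <-]|_ [U [oU AU] <-]]; exists U => //; rewrite munu.
Qed.

Lemma natural_measure_invariant (v : n.-tuple V)
    (mu : {measure set (borel_Gamma h) -> \bar R}) :
  basis_of {:V} v -> natural_measure_spec v mu ->
  forall (g : GL V) (A : set (borel_Gamma h)), measurable A ->
    pushforward mu (GL_act g : borel_Gamma h -> borel_Gamma h) A = mu A.
Proof.
move=> bv mu_spec.
(* On test functions the pushforward by [g] has the integrals prescribed by the basis [g v], which
   yields one inequality. *)
have le_open g (U : set (Gamma h)) : open U -> (mu U <= mu (GL_act g @^-1` U))%E.
  pose nu := measure_function_pushforward__canonical__measure_function_Measure mu
    (@GL_act_measurable R V p p' h g).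
  apply: (@natural_measure_le_open v _ mu nu bv (basis_GL g bv) mu_spec) => f cf sf f0.
  have mf : measurable_fun setT (fun x : borel_Gamma h => (f x)%:E).
    by apply/measurable_EFinP; exact: continuous_borel_measurable.
  rewrite (ge0_integral_pushforward (@GL_act_measurable R V p p' h g))//; last first.
    by move=> x _; rewrite lee_fin.
  rewrite -coord_integral_GL// preimage_setT; apply: (mu_spec.2 (f \o GL_act g)).
    by move=> x; apply: continuous_comp; [exact: GL_act_continuous|exact: cf].
  exact: compact_support_GL.
have preK g (A : set (Gamma h)) : GL_act (GL_inv g) @^-1` (GL_act g @^-1` A) = A.
  by apply/seteqP; split=> x /=; rewrite GL_actVK.
have pre_open g (U : set (Gamma h)) : open U -> open (GL_act g @^-1` U).
  by move=> oU; apply: open_comp => // x _; exact: GL_act_continuous.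
have eq_open g (U : set (Gamma h)) : open U -> mu (GL_act g @^-1` U) = mu U.
  move=> oU; apply/eqP; rewrite eq_le le_open// andbT.
  (* The reverse inequality is the same statement for the inverse of [g] and the preimage of [U]. *)
  by apply: le_trans (le_open (GL_inv g) _ (pre_open g _ oU)) _; rewrite preK.
have [[_ mu_outer _] _] := mu_spec.
have mpre g (A : set (borel_Gamma h)) : measurable A ->
    measurable (GL_act g @^-1` A : set (borel_Gamma h)).
  by move=> mA; rewrite -[X in measurable X]setTI; exact: GL_act_measurable.
(* Pulling back open supersets of [A] yields only an upper bound; using it again for the inverse of
   [g] and the preimage of [A] gives equality. *)
have le_pre g (A : set (borel_Gamma h)) : measurable A -> (mu (GL_act g @^-1` A) <= mu A)%E.
  move=> mA; rewrite (mu_outer A)//; apply: le_ereal_inf_tmp => _ [U [oU AU] <-].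
  rewrite -(eq_open g U)//; apply: le_measure; rewrite ?inE.
  - exact: mpre.
  - by apply: borel_open; exact: pre_open.
  - by move=> x; exact: AU.
move=> g A mA; apply/eqP; rewrite eq_le /pushforward le_pre//=.
by have := le_pre (GL_inv g) _ (mpre g _ mA); rewrite preK.
Qed.

End uniqueness.

Theorem mainTheorem6 (R : realType) (V : vectType R) (p p' : nat)
    (n_gt0 : (0 < \dim {:V})%N) (h : (p + p' = \dim {:V})%N) :
  (forall v : (\dim {:V}).-tuple V, basis_of {:V} v ->
     exists mu : {measure set (borel_Gamma h) -> \bar R},
       natural_measure_spec v mu) /\
  (forall v v' : (\dim {:V}).-tuple V, basis_of {:V} v -> basis_of {:V} v' ->
     forall mu mu' : {measure set (borel_Gamma h) -> \bar R},
       natural_measure_spec v mu -> natural_measure_spec v' mu' ->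
       forall A : set (borel_Gamma h), measurable A -> mu A = mu' A) /\
  (forall v : (\dim {:V}).-tuple V, basis_of {:V} v ->
     forall mu : {measure set (borel_Gamma h) -> \bar R},
       natural_measure_spec v mu ->
       forall (g : GL V) (A : set (borel_Gamma h)), measurable A ->
         pushforward mu (GL_act g : borel_Gamma h -> borel_Gamma h) A = mu A).
Proof.
split=> [v bv|]; first by exists (density_measure bv); exact: density_measure_spec.
split=> [v v' bv bv' mu mu'|v bv mu]; first exact: natural_measure_unique.
exact: natural_measure_invariant.
Qed.
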